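(* Let $r>0$ and $\phi\in C_+(\partial_r)$, i.e. $\phi:\partial_r\to[0,\infty)$ is continuous. Let $u,v\in C_+(\overline{\mathbb{X}}_r)$ (nonnegative continuous functions on $\overline{\mathbb{X}}_r$) be two constrained viscosity solutions on $\mathbb{X}_r$, with the Dirichlet boundary condition $\phi$, of the equation $$((\mathcal{L}+\beta)\psi-\ell)\vee \mathcal{H}(D\psi)=0 .$$ Then $u=v$.
   Context: **Geometry.** Let $k\le p$ be positive integers, $G$ a real $k\times p$ matrix of rank $k$, and let $\mathbb{X}\subset\mathbb{R}^k$, $\mathbb{Y}\subset\mathbb{R}^p$ and $\mathbb{U}:=G\mathbb{Y}\subset\mathbb{R}^k$ be closed convex cones with nonempty interior (a cone is a set closed under multiplication by scalars $\alpha\ge 0$), with $\mathbb{U}\cap\mathbb{X}^o\ne\varnothing$ ($^o$ denotes interior). There are a unit vector $\widehat u_1\in\mathbb{R}^k$, a unit vector $\widehat y_1\in\mathbb{R}^p$ and $a_0>0$, fixed throughout, with $u\cdot\widehat u_1\ge a_0|u|$ for $u\in\mathbb{U}$, $x\cdot\widehat u_1\ge a_0|x|$ for $x\in\mathbb{X}$, and $y\cdot\widehat y_1\ge a_0|y|$ for $y\in\mathbb{Y}$. For $r>0$, $\mathbb{X}_r:=\{x\in\mathbb{X}:x\cdot\widehat u_1<r\}$ and $\partial_r:=\{x\in\mathbb{X}:x\cdot\widehat u_1=r\}$; $\overline{\mathbb{X}}_r$ is the closure and $\mathbb{X}_r^o$ the interior of $\mathbb{X}_r$ in $\mathbb{R}^k$.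 **Data.** $\beta>0$, $b\in\mathbb{R}^k$, $\Sigma$ a symmetric nonnegative definite $k\times k$ matrix (possibly degenerate). $h:\mathbb{Y}\to\mathbb{R}$ is nonnegative, convex, globally Lipschitz with $h(\alpha y)=\alpha h(y)$, $\alpha\ge0$. $\ell:\mathbb{X}\to[0,\infty)$ is continuous, and there are $c_{\ell,1},c_{\ell,2},c_{\ell,3}\in(0,\infty)$, $m_\ell\in[0,\infty)$ with $c_{\ell,1}|x|^{m_\ell}-c_{\ell,2}\le\ell(x)\le c_{\ell,3}(|x|^{m_\ell}+1)$ on $\mathbb{X}$; moreover, with $\mathrm{mod}(r,\delta):=\sup\{\ell(x)-\ell(y):x,y\in\mathbb{X},|x|<r,|y|<r,|x-y|\le\delta\}$, one has $\mathrm{mod}(r+1,\delta)\le\widehat m(\delta)(1+r^{m_\ell})$ for $\delta,r>0$, where $\widehat m(0+)=0$. **PDE.** $\mathcal L:=-\tfrac12\mathrm{trace}(\Sigma D^2)-b\cdot D$; $\mathcal H(q):=\sup_{y\in\mathbb{Y}_1}-(Gy\cdot q+h(y))$, $q\in\mathbb{R}^k$, with $\mathbb{Y}_1=\{y\in\mathbb{Y}:|Gy|=1\}$. For $S\subset\mathbb{X}$, a continuous $\psi:\overline S\to[0,\infty)$ is a viscosity supersolution (resp., subsolution) of the equation on $S$ if for all $x\in S$ and all $\varphi\in C^2(S)$ for which $\psi-\varphi$ has a global minimum (resp., maximum) at $x$ one has $(\beta\psi(x)+\mathcal L\varphi(x)-\ell(x))\vee\mathcal H(D\varphi(x))\ge0$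 (resp., $\le0$). A continuous $\psi:\overline{\mathbb{X}}_r\to[0,\infty)$ is a constrained viscosity solution on $\mathbb{X}_r$ with the Dirichlet boundary condition $\phi$ if it is a viscosity supersolution on $\mathbb{X}_r$, a viscosity subsolution on $\mathbb{X}_r^o$, and $\psi=\phi$ on $\partial_r$. *)

(* Defs.v *)
From mathcomp Require Import all_boot all_order all_algebra.
From mathcomp Require Import all_classical all_reals all_analysis.

Set Implicit Arguments.
Unset Strict Implicit.
Unset Printing Implicit Defensive.

Import Order.TTheory GRing.Theory Num.Theory.
Import numFieldNormedType.Exports.

Local Open Scope classical_set_scope.
Local Open Scope ring_scope.

(* The library norm `|x| on 'cV[R]_n is the sup norm. It induces the usual
   topology, but the Euclidean length has to be introduced separately. *)
Definition dot (R : realType) (n : nat) (x y : 'cV[R]_n) : R :=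
  \sum_(i < n) x i 0 * y i 0.

Definition enorm (R : realType) (n : nat) (x : 'cV[R]_n) : R :=
  Num.sqrt (dot x x).

Definition cone (R : realType) (n : nat) (C : set 'cV[R]_n) : Prop :=
  forall (a : R) (x : 'cV[R]_n), 0 <= a -> C x -> C (a *: x).

Definition solid_closed_convex_cone (R : realType) (n : nat)
    (C : set 'cV[R]_n) : Prop :=
  [/\ closed C, convex_set C, cone C & C° !=set0].

Definition nonneg_definite (R : realType) (n : nat) (S : 'M[R]_n) : Prop :=
  S^T = S /\ forall x : 'cV[R]_n, 0 <= dot x (S *m x).

(* C_+(A), for total functions whose values outside A are irrelevant. *)
Definition Cplus (R : realType) (n : nat) (A : set 'cV[R]_n)
    (f : 'cV[R]_n -> R) : Prop :=
  {within A, continuous f} /\ forall x, A x -> 0 <= f x.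

Definition Xlt (R : realType) (k : nat) (X : set 'cV[R]_k) (u1 : 'cV[R]_k)
    (r : R) : set 'cV[R]_k :=
  [set x | X x /\ dot x u1 < r].

Definition Xeq (R : realType) (k : nat) (X : set 'cV[R]_k) (u1 : 'cV[R]_k)
    (r : R) : set 'cV[R]_k :=
  [set x | X x /\ dot x u1 = r].

(* The set is nonempty as soon as 0 \in X and r, delta > 0, and it is bounded
   above under the growth conditions on l, so the real-valued [sup] is the
   genuine supremum. *)
Definition modulus (R : realType) (k : nat) (X : set 'cV[R]_k)
    (l : 'cV[R]_k -> R) (r delta : R) : R :=
  sup [set z : R | exists x y : 'cV[R]_k,
    [/\ X x, X y, enorm x < r, enorm y < r & enorm (x - y) <= delta] /\
    z = l x - l y].

Definition partial (R : realType) (k : nat) (i : 'I_k) (f : 'cV[R]_k -> R) :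
    'cV[R]_k -> R :=
  'D_(delta_mx i 0 : 'cV[R]_k) f.

Definition grad (R : realType) (k : nat) (f : 'cV[R]_k -> R)
    (x : 'cV[R]_k) : 'cV[R]_k :=
  \col_i partial i f x.

Definition hess (R : realType) (k : nat) (f : 'cV[R]_k -> R)
    (x : 'cV[R]_k) : 'M[R]_k :=
  \matrix_(i, j) partial i (partial j f) x.

Definition C2_open (R : realType) (k : nat) (O : set 'cV[R]_k)
    (f : 'cV[R]_k -> R) : Prop :=
  forall x, O x ->
  [/\ {for x, continuous f},
      forall i, derivable f x (delta_mx i 0),
      forall i, {for x, continuous (partial i f)},
      forall i j, derivable (partial j f) x (delta_mx i 0) &
      forall i j, {for x, continuous (partial i (partial j f))}].

(* C^2 on a set S that need not be open: C^2 on some open neighbourhood of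
   S. *)
Definition C2_on (R : realType) (k : nat) (S : set 'cV[R]_k)
    (f : 'cV[R]_k -> R) : Prop :=
  exists O : set 'cV[R]_k, [/\ open O, S `<=` O & C2_open O f].

Definition calL (R : realType) (k : nat) (Sigma : 'M[R]_k) (b : 'cV[R]_k)
    (f : 'cV[R]_k -> R) (x : 'cV[R]_k) : R :=
  - (2^-1 * \tr (Sigma *m hess f x)) - dot b (grad f x).

(* The set is bounded above by the Euclidean norm of q when h is nonnegative
   on Y, and it is nonempty when G Y has nonempty interior in positive
   dimension, so the real-valued [sup] is the genuine supremum. *)
Definition calH (R : realType) (k p : nat) (G : 'M[R]_(k, p))
    (Y : set 'cV[R]_p) (h : 'cV[R]_p -> R) (q : 'cV[R]_k) : R :=
  sup [set - (dot (G *m y) q + h y) |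
       y in [set y : 'cV[R]_p | Y y /\ enorm (G *m y) = 1]].

(* The expression tested in the viscosity inequalities: z is the value of the
   candidate solution at x, f is the test function. *)
Definition hjb (R : realType) (k p : nat) (G : 'M[R]_(k, p))
    (Y : set 'cV[R]_p) (h : 'cV[R]_p -> R) (beta : R) (b : 'cV[R]_k)
    (Sigma : 'M[R]_k) (l : 'cV[R]_k -> R)
    (x : 'cV[R]_k) (z : R) (f : 'cV[R]_k -> R) : R :=
  Num.max (beta * z + calL Sigma b f x - l x) (calH G Y h (grad f x)).

(* Below, F x z f stands for the expression of the equation, see [hjb]. The
   extrema of psi - phi are global over S, the set on which phi is given. *)
Definition viscosity_supersolution (R : realType) (k : nat)
    (F : 'cV[R]_k -> R -> ('cV[R]_k -> R) -> R) (S : set 'cV[R]_k)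
    (psi : 'cV[R]_k -> R) : Prop :=
  Cplus (closure S) psi /\
  forall (x : 'cV[R]_k) (phi : 'cV[R]_k -> R), S x -> C2_on S phi ->
    (forall y, S y -> psi x - phi x <= psi y - phi y) ->
    0 <= F x (psi x) phi.

Definition viscosity_subsolution (R : realType) (k : nat)
    (F : 'cV[R]_k -> R -> ('cV[R]_k -> R) -> R) (S : set 'cV[R]_k)
    (psi : 'cV[R]_k -> R) : Prop :=
  Cplus (closure S) psi /\
  forall (x : 'cV[R]_k) (phi : 'cV[R]_k -> R), S x -> C2_on S phi ->
    (forall y, S y -> psi y - phi y <= psi x - phi x) ->
    F x (psi x) phi <= 0.

Definition constrained_viscosity_solution (R : realType) (k : nat)
    (F : 'cV[R]_k -> R -> ('cV[R]_k -> R) -> R) (X : set 'cV[R]_k)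
    (u1 : 'cV[R]_k) (r : R) (phi psi : 'cV[R]_k -> R) : Prop :=
  [/\ Cplus (closure (Xlt X u1 r)) psi,
      viscosity_supersolution F (Xlt X u1 r) psi,
      viscosity_subsolution F (Xlt X u1 r)° psi &
      forall x, Xeq X u1 r x -> psi x = phi x].

(* Main.v *)
Require Import Defs.
From mathcomp Require Import all_boot all_order all_algebra.
From mathcomp Require Import all_classical all_reals all_analysis.
From mathcomp Require Import ring lra.

(** Why uniqueness holds.

    The equation is convex in the unknown and its derivatives, and the
    second-order operator has constant coefficients.  Both features are kept
    by averaging over translations: if u is a viscosity subsolution, then a
    mollification of u should satisfy the two inequalities that make up
    [hjb <= 0] in the classical sense, with the running cost replaced by its
    own mollification.  Once this is known, a smooth function close to u can be
    used directly as a test function for the supersolution v.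

    The two inequalities are both linear with constant coefficients: the
    diffusion inequality, and, for each control y with
    |Gy| = 1, the transport inequality [- Gy . Du <= h y].  The second is the first with zero discount and zero
    diffusion, so one result, [mollified_subsolution], serves for both.  Its
    proof compares u with an approximate resolvent.  Write Sigma as a sum of
    squares s s^T and approximate the operator by a random walk with steps
    along the vectors s; a truncated Neumann series then yields a finite
    nonnegative combination A of translations which almost inverts
    lam + L for large lam = n + beta ([approx_resolvent]).  Since A acts by
    translations, A g is as smooth as g, and if g is a smooth approximation of
    f + n u then A g is an almost exact classical solution of
    (lam + L) w = f + n u.  Comparing u with it is elementary: u - A g minus a
    quadratic has a maximum, where A g plus the quadratic is a test function
    ([barrier_comparison]).  Hence lam (u - A (f + n u)) is at most a small
    constant, uniformly inside the domain.  This inequality contains no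
    derivative of u, so it can be mollified, and letting n grow turns it back
    into a differential inequality for the mollification.

    For the comparison, u is translated inward along an interior direction of
    the cone before it is mollified, so that the differential inequalities hold
    up to the lateral boundary, where v is a supersolution while u need not be
    a subsolution.  A small multiple of x . u1 is added: it makes the
    gradient inequality strict, because Gy . u1 >= a0 |Gy|.  At a minimum point
    of v minus this function either the point is close to the outer boundary,
    where u and v are both close to the same datum, or the supersolution property of v
    is contradicted, the discount beta giving the strict sign. *)

Set Implicit Arguments.
Unset Strict Implicit.
Unset Printing Implicit Defensive.

Import Order.TTheory GRing.Theory Num.Theory.
Import numFieldNormedType.Exports.

Local Open Scope classical_set_scope.
Local Open Scope ring_scope.

(** * Euclidean product and sup norm *)

Section Dot.
Variables (R : realType) (n : nat).
Implicit Types x y z : 'cV[R]_n.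

Lemma dotC x y : dot x y = dot y x.
Proof. by apply: eq_bigr => i _; rewrite mulrC. Qed.

Lemma dotDl x y z : dot (x + y) z = dot x z + dot y z.
Proof. by rewrite -big_split; apply: eq_bigr => i _; rewrite mxE mulrDl. Qed.

Lemma dotZl a x y : dot (a *: x) y = a * dot x y.
Proof. by rewrite mulr_sumr; apply: eq_bigr => i _; rewrite mxE mulrA. Qed.

Lemma dotDr x y z : dot x (y + z) = dot x y + dot x z.
Proof. by rewrite dotC dotDl !(dotC x). Qed.

Lemma dotZr a x y : dot x (a *: y) = a * dot x y.
Proof. by rewrite dotC dotZl dotC. Qed.

Lemma dotNl x y : dot (- x) y = - dot x y.
Proof. by rewrite -scaleN1r dotZl mulN1r. Qed.

Lemma dotNr x y : dot x (- y) = - dot x y.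
Proof. by rewrite dotC dotNl dotC. Qed.

Lemma dot0l x : dot 0 x = 0.
Proof. by rewrite -[0](scale0r (0 : 'cV[R]_n)) dotZl mul0r. Qed.

Lemma dot_ge0 x : 0 <= dot x x.
Proof. by apply: sumr_ge0 => i _; rewrite -expr2 sqr_ge0. Qed.

Lemma dot2_lower x y : - (dot x x + dot y y) <= 2 * dot x y.
Proof. by have := dot_ge0 (x + y); rewrite !(dotDl, dotDr) (dotC y x); lra. Qed.

Lemma dot2_upper x y : 2 * dot x y <= dot x x + dot y y.
Proof. by have := dot2_lower (- x) y; rewrite !(dotNl, dotNr); lra. Qed.

Lemma coord_le_norm x i : `|x i 0| <= `|x|.
Proof.
by rewrite [leRHS]/Num.Def.normr/= mx_normrE; exact: (le_bigmax _ _ (i, 0)).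
Qed.

Lemma norm_le_coord x c : 0 <= c -> (forall i, `|x i 0| <= c) -> `|x| <= c.
Proof.
move=> c0 H; rewrite [leLHS]/Num.Def.normr/= mx_normrE (bigmax_le _ c0)//= => -[i j] _ /=.
by rewrite (ord1 j).
Qed.

Lemma norm_sqr_le_dot x : `|x| ^+ 2 <= dot x x.
Proof.
rewrite -ler_sqrt ?dot_ge0// sqrtr_sqr normr_id.
apply: norm_le_coord; first exact: sqrtr_ge0.
move=> i; rewrite -sqrtr_sqr ler_sqrt ?dot_ge0//.
by rewrite /dot (bigD1 i)//= -expr2 lerDl sumr_ge0// => j _; rewrite -expr2 sqr_ge0.
Qed.

Lemma dot_le_norm x y : dot x y <= n%:R * (`|x| * `|y|).
Proof.
apply: (@le_trans _ _ (\sum_(i < n) `|x| * `|y|)); last first.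
  by rewrite sumr_const card_ord mulr_natl lexx.
apply: ler_sum => i _; apply: le_trans (ler_norm _) _; rewrite normrM.
by apply: ler_pM => //; exact: coord_le_norm.
Qed.

Lemma enorm_ge0 x : 0 <= enorm x. Proof. exact: sqrtr_ge0. Qed.

Lemma sqr_enorm x : enorm x ^+ 2 = dot x x.
Proof. by rewrite sqr_sqrtr // dot_ge0. Qed.

Lemma norm_le_enorm x : `|x| <= enorm x.
Proof.
by rewrite -[leLHS]normr_id -sqrtr_sqr ler_sqrt ?dot_ge0// norm_sqr_le_dot.
Qed.

Lemma cauchy_schwarz x y : dot x y <= enorm x * enorm y.
Proof.
have [x0|x0] := eqVneq (enorm x) 0.
  have : `|x| <= 0 by rewrite -x0 norm_le_enorm.
  by rewrite normr_le0 => /eqP ->; rewrite dot0l mulr_ge0 ?enorm_ge0.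
have [y0|y0] := eqVneq (enorm y) 0.
  have : `|y| <= 0 by rewrite -y0 norm_le_enorm.
  by rewrite normr_le0 => /eqP ->; rewrite dotC dot0l mulr_ge0 ?enorm_ge0.
have xp : 0 < enorm x by rewrite lt0r x0 enorm_ge0.
have yp : 0 < enorm y by rewrite lt0r y0 enorm_ge0.
have := dot2_upper ((enorm x)^-1 *: x) ((enorm y)^-1 *: y).
rewrite !(dotZl, dotZr) -!sqr_enorm.
have -> : (enorm x)^-1 * ((enorm x)^-1 * enorm x ^+ 2) +
   (enorm y)^-1 * ((enorm y)^-1 * enorm y ^+ 2) = 2 by field; apply/andP.
have -> : (enorm x)^-1 * ((enorm y)^-1 * dot x y) = dot x y / (enorm x * enorm y).
  by field; apply/andP.
by rewrite -[X in _ <= X]mulr1 ler_pM2l// ler_pdivrMr ?mulr_gt0// mul1r.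
Qed.

End Dot.

(** * Uniform continuity and uniform directional derivatives *)

Section UniformCalculus.
Variables (R : realType) (k : nat).
Notation V := 'cV[R]_k.
Implicit Types (f g : V -> R).

Definition unif_cont f := forall e : R, 0 < e ->
  exists2 d : R, 0 < d & forall x z, `|z| < d -> `|f (x + z) - f x| <= e.
Definition bounded_fct f := exists B : R, forall x, `|f x| <= B.
Definition BUC f := bounded_fct f /\ unif_cont f.

Lemma BUC_cst c : BUC (fun=> c).
Proof.
split; first by exists `|c|.
by move=> e e0; exists 1 => // x z _; rewrite subrr normr0 ltW.
Qed.

Lemma BUC_lin a f g : BUC f -> BUC g -> BUC (fun x => f x + a * g x).
Proof.
move=> [[B fB] fU] [[C gC] gU]; split.
  exists (B + `|a| * C) => x; apply: le_trans (ler_normD _ _) _.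
  by apply: lerD => //; rewrite normrM ler_wpM2l.
move=> e e0.
have [d1 d10 H1] := fU _ (divr_gt0 e0 (ltr0Sn _ 1)).
have a1 : 0 < `|a| + 1 by rewrite ltr_wpDl.
have [d2 d20 H2] := gU _ (divr_gt0 (divr_gt0 e0 (ltr0Sn _ 1)) a1).
exists (Num.min d1 d2); first by rewrite lt_min d10.
move=> x z; rewrite lt_min => /andP[/(H1 x) {}H1 /(H2 x) {}H2].
have -> : f (x + z) + a * g (x + z) - (f x + a * g x) =
  (f (x + z) - f x) + a * (g (x + z) - g x) by ring.
rewrite (splitr e); apply: le_trans (ler_normD _ _) (lerD H1 _).
rewrite normrM.
apply: (@le_trans _ _ ((`|a| + 1) * (e / 2 / (`|a| + 1)))).
  by apply: ler_pM => //; rewrite lerDl.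
by rewrite mulrC divfK// gt_eqF.
Qed.

Lemma BUC_shift f z : BUC f -> BUC (fun x => f (x + z)).
Proof.
move=> [[B fB] fU]; split; first by exists B.
move=> e /fU [d d0 H]; exists d => // x y /(H (x + z)).
by rewrite addrAC.
Qed.

Lemma unif_cont_continuous f : unif_cont f -> continuous f.
Proof.
move=> fU x; apply/(@cvgrPdist_le _ _ _ (nbhs x) (nbhs_filter x)) => e e0.
have [d d0 H] := fU _ e0.
apply: filterS (@nbhsx_ballx _ V x d d0) => y.
rewrite mx_norm_ball /ball_/= distrC => xy.
by have := H x (y - x) xy; rewrite [x + _]addrC subrK distrC.
Qed.

(** The remainder is controlled uniformly in the base point.  This
    uniformity passes to averages over translations without any exchange of
    limits, which is why derivatives are handled in this form; it is converted to
    [is_derive] only when a test function is needed. *)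
Definition unif_derive f (v : V) g := forall e : R, 0 < e ->
  exists2 d : R, 0 < d & forall x t, `|t| < d ->
    `|f (x + t *: v) - f x - t * g x| <= e * `|t|.

Lemma unif_derive_lin a f1 f2 v g1 g2 : unif_derive f1 v g1 -> unif_derive f2 v g2 ->
  unif_derive (fun x => f1 x + a * f2 x) v (fun x => g1 x + a * g2 x).
Proof.
move=> H1 H2 e e0.
have a1 : 0 < `|a| + 1 by rewrite ltr_wpDl.
have [d1 d10 {}H1] := H1 _ (divr_gt0 e0 (ltr0Sn _ 1)).
have [d2 d20 {}H2] := H2 _ (divr_gt0 (divr_gt0 e0 (ltr0Sn _ 1)) a1).
exists (Num.min d1 d2); first by rewrite lt_min d10.
move=> x t; rewrite lt_min => /andP[/(H1 x) {}H1 /(H2 x) {}H2].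
set A := f1 _ - _ - _ in H1; set B := f2 _ - _ - _ in H2.
have -> : f1 (x + t *: v) + a * f2 (x + t *: v) - (f1 x + a * f2 x) -
  t * (g1 x + a * g2 x) = A + a * B by rewrite /A /B; ring.
rewrite (splitr e) mulrDl; apply: le_trans (ler_normD _ _) (lerD H1 _).
rewrite normrM.
apply: (@le_trans _ _ ((`|a| + 1) * (e / 2 / (`|a| + 1) * `|t|))).
  by apply: ler_pM => //; rewrite lerDl.
by rewrite mulrA [(`|a| + 1) * _]mulrC divfK// gt_eqF.
Qed.

Lemma unif_derive_shift f v g z : unif_derive f v g ->
  unif_derive (fun x => f (x + z)) v (fun x => g (x + z)).
Proof.
move=> H e /H [d d0 {}H]; exists d => // x t /(H (x + z)).
by rewrite [x + z + _]addrAC.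
Qed.

Lemma unif_derive_scale f v g c : unif_derive f v g -> unif_derive f (c *: v) (fun x => c * g x).
Proof.
move=> H e e0.
have c1 : 0 < `|c| + 1 by rewrite ltr_wpDl.
have [d d0 {}H] := H _ (divr_gt0 e0 c1).
exists (d / (`|c| + 1)); first by rewrite divr_gt0.
move=> x t; rewrite ltr_pdivlMr// => td.
have tc : `|t * c| <= `|t| * (`|c| + 1) by rewrite normrM ler_wpM2l// lerDl.
have := H x (t * c) (le_lt_trans tc td).
rewrite scalerA -mulrA => /le_trans; apply.
apply: (@le_trans _ _ (e / (`|c| + 1) * (`|t| * (`|c| + 1)))).
  by rewrite ler_wpM2l// ltW ?divr_gt0.
by rewrite [`|t| * _]mulrC mulrA divfK// gt_eqF.
Qed.

Lemma unif_derive_is_derive f v g x : unif_derive f v g -> is_derive x v f (g x).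
Proof.
move=> H.
have cv : h^-1 *: (f (h *: v + x) - f x) @[h --> 0^'] --> g x.
  apply/cvgrPdist_le => e e0; have [d d0 {}H] := H _ e0.
  near=> h.
  have h0 : h != 0 by near: h; exact: nbhs_dnbhs_neq.
  have hd : `|h| < d by near: h; exact: dnbhs0_lt.
  have := H x h hd; rewrite [x + _]addrC -ler_pdivrMr ?normr_gt0// -normf_div.
  set D := f _ - f _; rewrite distrC.
  suff -> : h^-1 *: D - g x = (D - h * g x) / h by [].
  by rewrite (_ : h^-1 *: D = h^-1 * D)//; field.
split; first by apply/cvg_ex; exists (g x).
exact/cvg_lim.
Unshelve. all: by end_near. Qed.

End UniformCalculus.

(** * Averages over segments *)

Section Primitive.
Variable (R : realType).
Implicit Types (p P : R -> R).

Definition primitive_on (a b : R) p P :=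
  forall t, a <= t <= b -> is_derive t 1 P (p t).

Lemma primitive_exists p : continuous p -> exists P, primitive_on (-1) 2 p P.
Proof.
move=> pc.
exists (fun x => (\int[lebesgue_measure]_(t in [set` `[-2, x]]) (p t))%R) => x /andP[x1 x2].
have := @continuous_FTC1_closed R p (-2) x 3.
have x3 : x < 3 by lra.
have x4 : -2 < x by lra.
move=> /(_ x3) H.
have /H /(_ x4 (pc x)) [D1 D2] : lebesgue_measure.-integrable `[(-2), 3] (EFin \o p).
  apply: continuous_compact_integrable; first exact: segment_compact.
  exact: continuous_subspaceT.
apply: DeriveDef; first exact: D1.
by rewrite -derive1E.
Qed.

(** The mean value inequality; applied to a primitive of 0 and its opposite,
    it shows that two primitives have the same increments. *)
Lemma primitive_le a b c p P : a <= b -> primitive_on a b p P ->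
  (forall t, a <= t <= b -> p t <= c) -> P b - P a <= c * (b - a).
Proof.
move=> ab pP pc.
have [|| t tab ->] := @MVT_segment R P p a b ab.
- by move=> x; rewrite in_itv/= => /andP[/ltW ax /ltW xb]; apply: pP; rewrite ax.
- apply: derivable_within_continuous => x; rewrite in_itv/= => xab.
  by have [] := pP x xab.
by rewrite ler_wpM2r ?subr_ge0 ?pc//; move: tab; rewrite in_itv.
Qed.

Lemma primitiveN a b p P : primitive_on a b p P ->
  primitive_on a b (fun t => - p t) (fun t => - P t).
Proof. by move=> H t /H h; exact: is_deriveN. Qed.

Lemma primitive_dist a b c d p P : a <= b -> primitive_on a b p P ->
  (forall t, a <= t <= b -> `|p t - c| <= d) ->
  `|P b - P a - c * (b - a)| <= d * (b - a).
Proof.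
move=> ab pP H; rewrite ler_norml; apply/andP; split.
  have := primitive_le ab (primitiveN pP) (c := d - c).
  have h t : a <= t <= b -> - p t <= d - c by move/H; rewrite ler_norml; lra.
  by move/(_ h); lra.
have := primitive_le ab pP (c := d + c).
have h t : a <= t <= b -> p t <= d + c by move/H; rewrite ler_norml; lra.
by move/(_ h); lra.
Qed.

(** The mean of [p] over [0, 1].  It is taken through a primitive on a larger
    interval, so that the derivative of the mean under a translation of [p] is
    the fundamental theorem of calculus at both end points; linearity, positivity
    and translations all reduce to [mean01P]. *)
Definition mean01 p : R :=
  let P := xget (cst 0) [set P | primitive_on (-1) 2 p P] in P 1 - P 0.

Lemma mean01P p P : continuous p -> primitive_on 0 1 p P -> mean01 p = P 1 - P 0.
Proof.
move=> pc pP; rewrite /mean01; case: xgetP => [Q _ /= qP|/(_ _)]; last first.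
  by case: (primitive_exists pc) => Q ? /(_ Q).
have D : primitive_on 0 1 (fun t => p t + - p t) (fun t => Q t + - P t).
  move=> t t01; apply: is_deriveD; last by apply: is_deriveN; exact: pP.
  by apply: qP; move: t01; lra.
have := primitive_dist ler01 D (c := 0) (d := 0).
have h (t : R) : 0 <= t <= 1 -> `|p t + - p t - 0| <= 0 by rewrite subrr subr0 normr0.
move=> /(_ h); rewrite mul0r normr_le0 subr0 => /eqP; lra.
Qed.

Lemma mean01E p : continuous p -> exists2 P, primitive_on (-1) 2 p P & mean01 p = P 1 - P 0.
Proof.
move=> pc; have [P pP] := primitive_exists pc; exists P => //.
by apply: mean01P => // t t01; apply: pP; lra.
Qed.

End Primitive.

Section Averaging.
Variables (R : realType) (k : nat).
Notation V := 'cV[R]_k.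
Implicit Types (f g : V -> R).

(** The properties of convolution with a probability measure supported
    in the ball of radius [rho], stated without an integral so that compositions
    of one-dimensional averages qualify. *)
Record averaging (rho : R) (M : (V -> R) -> V -> R) : Prop := Averaging {
  avg_BUC : forall f, BUC f -> BUC (M f);
  avg_lin : forall a f g x, BUC f -> BUC g ->
    M (fun y => f y + a * g y) x = M f x + a * M g x;
  avg_local : forall f x c, BUC f -> (forall z, `|z| <= rho -> f (x + z) <= c) ->
    M f x <= c;
  avg_shift : forall f x z, M (fun y => f (y + z)) x = M f (x + z) }.

Section Theory.
Variables (rho : R) (M : (V -> R) -> V -> R).
Hypothesis MA : averaging rho M.

Lemma avg_local_ge f x c : BUC f -> (forall z, `|z| <= rho -> c <= f (x + z)) ->
  c <= M f x.
Proof.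
move=> fB H; have B0 := BUC_cst k (0 : R).
have := avg_lin MA (-1) x B0 fB.
have N := BUC_lin (-1) B0 fB.
have : M (fun y => 0 + -1 * f y) x <= - c.
  by apply: (avg_local MA) => // z /H; lra.
have : 0 <= M (fun=> 0) x.
  have := avg_lin MA (-1) x B0 B0.
  rewrite (_ : (fun y : V => 0 + -1 * 0) = fun=> 0); last by apply/funext => y; ring.
  by lra.
have : M (fun=> 0) x <= 0 by apply: (avg_local MA).
lra.
Qed.

Lemma avg_cst c x : M (fun=> c) x = c.
Proof.
have B := BUC_cst k c.
by apply/eqP; rewrite eq_le (avg_local MA)// avg_local_ge.
Qed.

Lemma avg_sub f g x : BUC f -> BUC g ->
  M (fun y => f y - g y) x = M f x - M g x.
Proof.
move=> fB gB; have := avg_lin MA (-1) x fB gB; rewrite mulN1r => <-; congr M.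
by apply/funext => y; rewrite mulN1r.
Qed.

Lemma avg_dist f x c d : BUC f -> (forall z, `|z| <= rho -> `|f (x + z) - d| <= c) ->
  `|M f x - d| <= c.
Proof.
move=> fB H; rewrite ler_norml; apply/andP; split.
  suff : d - c <= M f x by lra.
  by apply: avg_local_ge => // z /H; rewrite ler_norml; lra.
suff : M f x <= d + c by lra.
by apply: (avg_local MA) => // z /H; rewrite ler_norml; lra.
Qed.

(** The operator commutes with translations, so it acts on the difference
    quotient of [f]; locality bounds the average of the remainder. *)
Lemma avg_unif_derive f g v : BUC f -> BUC g -> unif_derive f v g -> unif_derive (M f) v (M g).
Proof.
move=> fB gB H e e0; have [d d0 {}H] := H _ e0; exists d => // x t td.
have fS := BUC_shift (t *: v) fB.
have fD := BUC_lin (-1) fS fB.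
have fE := BUC_lin (- t) fD gB.
have : `|M (fun y => f (y + t *: v) + -1 * f y + - t * g y) x - 0| <= e * `|t|.
  apply: avg_dist => // z _; rewrite subr0.
  by have := H (x + z) t td; rewrite mulN1r mulNr.
by rewrite (avg_lin MA)// (avg_lin MA)// (avg_shift MA)// subr0 mulN1r mulNr.
Qed.

End Theory.

Lemma avg_comp r1 r2 M1 M2 : averaging r1 M1 -> averaging r2 M2 ->
  averaging (r1 + r2) (fun f => M1 (M2 f)).
Proof.
move=> A1 A2; split.
- by move=> f fB; apply/(avg_BUC A1)/(avg_BUC A2).
- move=> a f g x fB gB.
  rewrite (_ : M2 _ = fun y => M2 f y + a * M2 g y); last first.
    by apply/funext => y; rewrite (avg_lin A2).
  by rewrite (avg_lin A1)//; apply: (avg_BUC A2).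
- move=> f x c fB H; apply: (avg_local A1); first exact: (avg_BUC A2).
  move=> z1 h1; apply: (avg_local A2) => // z2 h2; rewrite -addrA; apply: H.
  by apply: le_trans (ler_normD _ _) _; exact: lerD.
- move=> f x z; rewrite -(avg_shift A1); congr M1.
  by apply/funext => y; rewrite (avg_shift A2).
Qed.

Definition segment_avg (v : V) f x : R := mean01 (fun t => f (x + t *: v)).

Lemma line_continuous f x v : unif_cont f -> continuous (fun t : R => f (x + t *: v)).
Proof.
move=> fU t; apply/cvgrPdist_le => e e0; have [d d0 H] := fU _ e0.
have v1 : 0 < `|v| + 1 by rewrite ltr_wpDl.
apply: filterS (@nbhsx_ballx _ _ t _ (divr_gt0 d0 v1)) => s.
rewrite /ball/= => ts; rewrite distrC.
have := H (x + t *: v) ((s - t) *: v).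
rewrite -addrA -scalerDl [t + _]addrC subrK; apply.
rewrite normrZ distrC; apply: (@le_lt_trans _ _ (`|t - s| * (`|v| + 1))).
  by rewrite ler_wpM2l// lerDl.
by rewrite -ltr_pdivlMr.
Qed.

Lemma segment_avg_le f x v c : unif_cont f -> (forall t, 0 <= t <= 1 -> f (x + t *: v) <= c) ->
  segment_avg v f x <= c.
Proof.
move=> fU H; rewrite /segment_avg.
have [P pP ->] := mean01E (@line_continuous f x v fU).
rewrite -[c]mulr1 -[in c * _](subr0 (1:R)).
apply: (@primitive_le _ 0 1 c (fun t => f (x + t *: v))) => //.
by move=> t t01; apply: pP; lra.
Qed.

Lemma segment_avg_lin v a f g x : unif_cont f -> unif_cont g ->
  segment_avg v (fun y => f y + a * g y) x = segment_avg v f x + a * segment_avg v g x.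
Proof.
move=> fU gU; rewrite /segment_avg.
have fc := @line_continuous f x v fU.
have gc := @line_continuous g x v gU.
have [P pP ->] := mean01E fc; have [Q qQ ->] := mean01E gc.
rewrite (@mean01P _ _ (fun t => P t + a * Q t)); first by ring.
  move=> t; apply: cvgD; first exact: fc.
  by apply: cvgM; [exact: cvg_cst | exact: gc].
move=> t t01; have t12 : -1 <= t <= 2 by lra.
have D1 := pP t t12; have D2 := qQ t t12.
apply: is_deriveD.
Qed.

Lemma segment_avg_shift v f x z : segment_avg v (fun y => f (y + z)) x = segment_avg v f (x + z).
Proof. by rewrite /segment_avg; congr mean01; apply/funext => t; rewrite addrAC. Qed.

Lemma segment_avg_averaging v rho : `|v| <= rho -> averaging rho (segment_avg v).
Proof.
move=> vr.
have loc f x c : BUC f -> (forall z, `|z| <= rho -> f (x + z) <= c) ->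
    segment_avg v f x <= c.
  move=> [_ fU] H; apply: segment_avg_le => // t /andP[t0 t1]; apply: H.
  rewrite normrZ ger0_norm//; apply: le_trans vr.
  by rewrite ler_piMl.
have lin a f g x : BUC f -> BUC g ->
    segment_avg v (fun y => f y + a * g y) x = segment_avg v f x + a * segment_avg v g x.
  by move=> [_ fU] [_ gU]; exact: segment_avg_lin.
split => //; last by move=> *; exact: segment_avg_shift.
have abs f x c : BUC f -> (forall y, `|f y| <= c) -> `|segment_avg v f x| <= c.
  move=> fB H; rewrite ler_norml; apply/andP; split.
    have B0 := BUC_cst k (0 : R).
    have := loc _ x c (BUC_lin (-1) B0 fB).
    rewrite lin// => h.
    have : segment_avg v (fun=> 0) x + -1 * segment_avg v f x <= c.
      by apply: h => z _; have := H (x + z); rewrite ler_norml; lra.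
    have := lin (-1) _ _ x B0 B0.
    rewrite (_ : (fun y : V => 0 + -1 * 0) = fun=> 0); last by apply/funext => y; ring.
    by lra.
  by apply: loc => // z _; have := H (x + z); rewrite ler_norml; lra.
move=> f fB; have [[B fb] fU] := fB; split.
  by exists B => x; exact: abs.
move=> e e0; have [d d0 H] := fU _ e0; exists d => // x z zd.
have -> : segment_avg v f (x + z) - segment_avg v f x =
    segment_avg v (fun y => f (y + z) + -1 * f y) x.
  by rewrite lin ?segment_avg_shift ?mulN1r//; exact: BUC_shift.
apply: abs; first by apply: BUC_lin => //; exact: BUC_shift.
by move=> y; rewrite mulN1r; exact: H.
Qed.

(** Sliding the segment along its own direction changes the
    integral only at the two ends, so averaging along [v] gains one derivative
    along [v]. *)
Lemma segment_avg_unif_derive v f : BUC f -> unif_derive (segment_avg v f) v (fun x => f (x + v) - f x).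
Proof.
move=> [_ fU] e e0.
have [d d0 H] := fU _ (divr_gt0 e0 (ltr0Sn _ 1)).
have v1 : 0 < `|v| + 1 by rewrite ltr_wpDl.
exists (Num.min 1 (d / (`|v| + 1))).
  by rewrite lt_min ltr01 divr_gt0.
move=> x t; rewrite lt_min => /andP[t1]; rewrite ltr_pdivlMr// => td.
rewrite {2}/segment_avg; have [P pP ->] := mean01E (@line_continuous f x v fU).
have t1' : - t < 1 /\ t < 1 by have := t1; rewrite ltr_norml; lra.
have -> : segment_avg v f (x + t *: v) = P (1 + t) - P (0 + t).
  rewrite /segment_avg (@mean01P _ _ (fun s => P (s + t)))//.
    exact: line_continuous.
  move=> s s01; rewrite -addrA -scalerDl [t + s]addrC.
  have D : is_derive (s + t) 1 P (f (x + (s + t) *: v)) by apply: pP; lra.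
  have := is_derive1_comp (f := P) (g := shift t) D (is_derive_shift s 1 t).
  by rewrite mulr1.
(* on a segment of length |t| the primitive is linear up to the oscillation *)
have key (s : R) : 0 <= s <= 1 -> `|P (s + t) - P s - t * f (x + s *: v)| <= e / 2 * `|t|.
  move=> s01.
  have osc r : `|r - s| <= `|t| -> `|f (x + r *: v) - f (x + s *: v)| <= e / 2.
    move=> rs; have := H (x + s *: v) ((r - s) *: v).
    rewrite -addrA -scalerDl [s + _]addrC subrK; apply.
    rewrite normrZ; apply: le_lt_trans td.
    by apply: ler_pM => //; rewrite lerDl.
  have [t0|t0] := leP 0 t.
    have := @primitive_dist _ s (s + t) (f (x + s *: v)) (e / 2) (fun r => f (x + r *: v)) P.
    rewrite [s + t - s]addrAC subrr add0r (ger0_norm t0) [t * _]mulrC; apply.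
    - by rewrite lerDl.
    - by move=> r rs; apply: pP; lra.
    - by move=> r rs; apply: osc; rewrite !ger0_norm; lra.
  have := @primitive_dist _ (s + t) s (f (x + s *: v)) (e / 2) (fun r => f (x + r *: v)) P.
  rewrite (_ : s - (s + t) = - t); last by ring.
  rewrite (ltr0_norm t0) -normrN (_ : - (P s - _ - _) = P (s + t) - P s - t * f (x + s *: v)); last by ring.
  apply.
  - by lra.
  - by move=> r rs; apply: pP; lra.
  - by move=> r rs; apply: osc; rewrite !ler0_norm; lra.
have K1 := key 1; have K0 := key 0.
rewrite scale1r in K1; rewrite scale0r addr0 in K0.
have {}K1 := K1 ltac:(lra); have {}K0 := K0 ltac:(lra).
have -> : P (1 + t) - P (0 + t) - (P 1 - P 0) - t * (f (x + v) - f x) =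
  (P (1 + t) - P 1 - t * f (x + v)) - (P (0 + t) - P 0 - t * f x) by ring.
by apply: le_trans (ler_normB _ _) _; rewrite (splitr e) mulrDl; exact: lerD.
Qed.

End Averaging.

(** * Mollification *)

Section Mollifier.
Variables (R : realType) (k : nat).
Notation V := 'cV[R]_k.
Implicit Types (f g : V -> R) (s : seq 'I_k).

Definition unit_vec (i : 'I_k) : V := delta_mx i 0.

Lemma norm_unit_vec i : `|unit_vec i| <= 1.
Proof.
apply: norm_le_coord => // j; rewrite mxE.
by case: (_ && _); rewrite ?normr1 ?normr0.
Qed.

(** One derivative may be taken for each entry of the list, in any order;
    an entry is consumed by the derivative along the corresponding coordinate. *)
Inductive smooth_along : seq 'I_k -> (V -> R) -> Prop :=
  Smooth s f (D : 'I_k -> V -> R) :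
    BUC f -> (forall i, i \in s -> unif_derive f (unit_vec i) (D i)) ->
    (forall i, i \in s -> smooth_along (rem i s) (D i)) -> smooth_along s f.

Lemma smooth_along_BUC s f : smooth_along s f -> BUC f.
Proof. by case. Qed.

Lemma smooth_along_shift s f z : smooth_along s f -> smooth_along s (fun x => f (x + z)).
Proof.
elim=> {}s {}f D fB fD _ IH.
apply: (@Smooth _ _ (fun i x => D i (x + z))) => //.
- exact: BUC_shift.
- by move=> i /fD; exact: unif_derive_shift.
Qed.

Lemma smooth_along_lin s f g a : smooth_along s f -> smooth_along s g ->
  smooth_along s (fun x => f x + a * g x).
Proof.
move=> fS; elim: fS g => {}s {}f D fB fD _ IH g gS.
case: gS IH fD => {}s {}g E gB gE gS IH fD.
apply: (@Smooth _ _ (fun i x => D i x + a * E i x)).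
- exact: BUC_lin.
- by move=> i si; apply: unif_derive_lin; [exact: fD | exact: gE].
- by move=> i si; apply: IH => //; exact: gS.
Qed.

Lemma smooth_along_scale s f a : smooth_along s f -> smooth_along s (fun x => a * f x).
Proof.
move=> fS; have := smooth_along_lin (a - 1) fS fS.
by congr smooth_along; apply/funext => x; ring.
Qed.

(** Along the averaged coordinate the derivative is a difference of
    translates; along any other coordinate it commutes with the average. *)
Lemma smooth_along_segment_avg s f i c : c != 0 -> smooth_along s f ->
  smooth_along (i :: s) (segment_avg (c *: unit_vec i) f).
Proof.
move=> c0; elim=> {}s {}f D fB fD Ds IH.
have A := segment_avg_averaging (lexx `|c *: unit_vec i|).
apply: (@Smooth _ _ (fun j => if j == i
    then fun x => c^-1 * (f (x + c *: unit_vec i) + -1 * f x)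
    else segment_avg (c *: unit_vec i) (D j))).
- exact: (avg_BUC A).
- move=> j; rewrite inE; case: eqVneq => [-> _|_ /= js].
    have := unif_derive_scale c^-1 (segment_avg_unif_derive (c *: unit_vec i) fB).
    rewrite scalerA mulVf// scale1r.
    by congr unif_derive; apply/funext => x; rewrite mulN1r.
  by apply: (avg_unif_derive A) => //; [exact: smooth_along_BUC (Ds j js) | exact: fD].
- move=> j; rewrite inE /= [i == j]eq_sym; case: eqVneq => [-> _|_ /= js].
    have fS : smooth_along s f by apply: (@Smooth _ _ D).
    by apply: smooth_along_scale; apply: smooth_along_lin => //; exact: smooth_along_shift.
  exact: IH.
Qed.

(** Uniform bounds up to order two, as opposed to mere continuity, make
    finite-difference approximations converge uniformly on the whole space. *)
Record BUC2 f (g : 'I_k -> V -> R) (H : 'I_k -> 'I_k -> V -> R) : Prop := BUC2_intro {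
  BUC2_BUC : BUC f;
  BUC2_grad : forall i, unif_derive f (unit_vec i) (g i);
  BUC2_gradB : forall i, BUC (g i);
  BUC2_hess : forall i j, unif_derive (g j) (unit_vec i) (H i j);
  BUC2_hessB : forall i j, BUC (H i j) }.

Lemma smooth_along_BUC2 s f : (forall i, (2 <= count_mem i s)%N) -> smooth_along s f ->
  exists (g : 'I_k -> V -> R) H, BUC2 f g H.
Proof.
move=> s2 fS; case: fS s2 => {}s {}f g fB fg gS s2.
have si i : i \in s by rewrite -has_pred1 has_count; exact: leq_trans (s2 i).
have sij i j : i \in rem j s.
  by rewrite -has_pred1 has_count count_rem; have := s2 i; case: (_ && _); case: (count _ _) => [|[]].
have /choice[H HH] : forall j, exists H, forall i, unif_derive (g j) (unit_vec i) (H i) /\ BUC (H i).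
  have inv t h : smooth_along t h -> (forall i, i \in t) ->
      exists H, forall i, unif_derive h (unit_vec i) (H i) /\ BUC (H i).
    case=> {}t {}h D _ hD DS ti; exists D => i.
    by split; [exact: hD|exact: smooth_along_BUC (DS i (ti i))].
  by move=> j; apply: inv (gS j (si j)) _ => i; exact: sij.
exists g, (fun i j => H j i); split=> //.
- by move=> i; exact: fg.
- by move=> i; exact: smooth_along_BUC (gS i _).
- by move=> i j; have [] := HH j i.
- by move=> i j; have [] := HH j i.
Qed.

(** Averaging twice along each coordinate over segments of length [c]
    yields two derivatives in every pair of directions; the composition of all
    the averages moves points by at most [c] times their number. *)
Lemma mollifier_exists (rho : R) : 0 < rho ->
  exists M, averaging rho M /\ forall f, BUC f -> exists (g : 'I_k -> V -> R) H, BUC2 (M f) g H.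
Proof.
move=> rho0; pose s := enum 'I_k ++ enum 'I_k.
pose c := rho / (size s).+1%:R.
have c0 : 0 < c by rewrite divr_gt0.
pose Mo := foldr (fun i (M : (V -> R) -> V -> R) f => segment_avg (c *: unit_vec i) (M f)) id.
have cn i : `|c *: unit_vec i| <= c.
  by rewrite normrZ (gtr0_norm c0) ler_piMr ?norm_unit_vec// ltW.
have A t : averaging (c * (size t)%:R) (Mo t).
  elim: t => [|i t IH] /=.
    split => // f x d fB H; rewrite -[x in f x]addr0; apply: H.
    by rewrite normr0 mulr0.
  rewrite -nat1r mulrDr mulr1.
  exact: avg_comp (segment_avg_averaging (cn i)) IH.
have SM t f : BUC f -> smooth_along t (Mo t f).
  move=> fB; elim: t => [|i t IH] /=; first by apply: (@Smooth _ _ (fun _ _ => 0)).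
  by apply: smooth_along_segment_avg => //; rewrite gt_eqF.
exists (Mo s); split.
  have [a b d e] := A s; split => // f x y fB H; apply: d => // z zs; apply: H.
  apply: le_trans zs _; rewrite /c mulrAC ler_pdivrMr ?ltr0Sn//.
  by rewrite ler_wpM2l ?ler_nat// ltW.
move=> f fB; apply: smooth_along_BUC2 (SM s f fB) => i.
by rewrite count_cat count_uniq_mem ?enum_uniq// mem_enum.
Qed.

End Mollifier.

(** * Uniform Taylor expansions *)

Section Taylor.
Variables (R : realType) (k : nat).
Notation V := 'cV[R]_k.
Implicit Types (f g : V -> R) (G : 'I_k -> V -> R) (H : 'I_k -> 'I_k -> V -> R).

Lemma unif_derive_line f v g x (t : R) : unif_derive f v g ->
  is_derive t 1 (fun s : R => f (x + s *: v)) (g (x + t *: v)).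
Proof.
move=> /(@unif_derive_is_derive _ _ _ _ _ (x + t *: v)) [D <-].
have E : (fun h : R => h^-1 *: (f (x + (h *: 1 + t) *: v) - f (x + t *: v))) =
    (fun h : R => h^-1 *: (f (h *: v + (x + t *: v)) - f (x + t *: v))).
  apply/funext => h; congr (_ *: (f _ - _)).
  by rewrite [_ *: (1 : R)]mulr1 scalerDl addrCA.
split; first by rewrite /derivable E.
by rewrite /derive E.
Qed.

Lemma coord_sum (z : V) : z = \sum_i z i 0 *: unit_vec R i.
Proof.
apply/matrixP => i j; rewrite (ord1 j) summxE (bigD1 i)//= !mxE !eqxx mulr1.
rewrite big1 ?addr0// => l /negPf li; rewrite !mxE.
by rewrite [i == l]eq_sym li mulr0.
Qed.

(** The increment is decomposed into coordinate moves; each is governed by a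
    uniform partial derivative, evaluated at a point close to the base point. *)
Lemma taylor1 f G : (forall i, unif_derive f (unit_vec R i) (G i)) -> (forall i, unif_cont (G i)) ->
  forall e : R, 0 < e -> exists2 d : R, 0 < d & forall (x z : V), `|z| < d ->
    `|f (x + z) - f x - \sum_i z i 0 * G i x| <= e * `|z|.
Proof.
move=> fG GU e e0.
suff [d d0 H] : exists2 d : R, 0 < d & forall (x z : V), `|z| < d ->
    `|f (x + \sum_(i <- index_enum 'I_k) z i 0 *: unit_vec R i) - f x -
      \sum_(i <- index_enum 'I_k) z i 0 * G i x| <= e * `|z|.
  by exists d => // x z /(H x); rewrite -coord_sum.
elim: (index_enum _) e e0 => [|i s IH] e e0.
  exists 1 => // x z _; rewrite !big_nil addr0 subrr subr0 normr0.
  by rewrite mulr_ge0// ltW.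
have e3 : 0 < e / 3 by rewrite divr_gt0.
have [d1 d10 H1] := IH _ e3.
have [d2 d20 H2] := fG i _ e3.
have [d3 d30 H3] := GU i _ e3.
have s1 : 0 < (size s).+1%:R :> R by rewrite ltr0Sn.
exists (Num.min d1 (Num.min d2 (d3 / (size s).+1%:R))).
  by rewrite !lt_min d10 d20 divr_gt0.
move=> x z; rewrite !lt_min => /and3P[zd1 zd2]; rewrite ltr_pdivlMr// => zd3.
have zi := coord_le_norm z i.
rewrite !big_cons [_ *: _ + _]addrC addrA.
set w := \sum_(j <- s) _ *: _; set S := \sum_(j <- s) _ * _.
have wn : `|w| < d3.
  apply: le_lt_trans zd3; apply: le_trans (ler_norm_sum _ _ _) _.
  apply: (@le_trans _ _ (\sum_(j <- s) `|z|)).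
    apply: ler_sum => j _; rewrite normrZ.
    by apply: le_trans (coord_le_norm z j); rewrite ler_piMr// norm_unit_vec.
  by rewrite big_const_seq iter_addr_0 count_predT -[leLHS]mulr_natr ler_wpM2l// ler_nat.
have E1 := H1 x z zd1; have E2 := H2 (x + w) (z i 0) (le_lt_trans zi zd2).
have E3 := H3 x w wn; rewrite -/w -/S in E1.
have -> : f (x + w + z i 0 *: unit_vec R i) - f x - (z i 0 * G i x + S) =
  (f (x + w + z i 0 *: unit_vec R i) - f (x + w) - z i 0 * G i (x + w)) +
  z i 0 * (G i (x + w) - G i x) + (f (x + w) - f x - S) by ring.
have -> : e * `|z| = e / 3 * `|z| + `|z| * (e / 3) + e / 3 * `|z| by field.
apply: le_trans (ler_normD _ _) (lerD _ E1).
apply: le_trans (ler_normD _ _) (lerD _ _).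
  by apply: le_trans E2 _; rewrite ler_wpM2l// ltW.
by rewrite normrM; apply: ler_pM.
Qed.

Lemma unif_derive_dir f G (v : V) : (forall i, unif_derive f (unit_vec R i) (G i)) ->
  (forall i, unif_cont (G i)) -> unif_derive f v (fun x => \sum_i v i 0 * G i x).
Proof.
move=> fG GU e e0.
have v1 : 0 < `|v| + 1 by rewrite ltr_wpDl.
have [d d0 H] := taylor1 fG GU (divr_gt0 e0 v1).
exists (d / (`|v| + 1)); first by rewrite divr_gt0.
move=> x t; rewrite ltr_pdivlMr// => td.
have tv : `|t *: v| <= `|t| * (`|v| + 1) by rewrite normrZ ler_wpM2l// lerDl.
have := H x (t *: v) (le_lt_trans tv td).
rewrite (_ : \sum_i _ = t * \sum_i v i 0 * G i x); last first.
  by rewrite mulr_sumr; apply: eq_bigr => i _; rewrite mxE mulrA.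
move=> /le_trans; apply.
apply: (@le_trans _ _ (e / (`|v| + 1) * (`|t| * (`|v| + 1)))).
  by rewrite ler_wpM2l// ltW// divr_gt0.
by rewrite [`|t| * _]mulrC mulrA divfK// gt_eqF.
Qed.

Lemma unif_derive_sum (I : Type) (s : seq I) (F E : I -> V -> R) (c : I -> R) v :
  (forall i, unif_derive (F i) v (E i)) ->
  unif_derive (fun x => \sum_(i <- s) c i * F i x) v (fun x => \sum_(i <- s) c i * E i x).
Proof.
move=> FE; elim: s => [|i s IH].
  move=> e e0; exists 1 => // x t _; rewrite !big_nil mulr0 !subr0 normr0.
  by rewrite mulr_ge0// ltW.
have := unif_derive_lin (c i) IH (FE i).
by congr unif_derive; apply/funext => x; rewrite big_cons addrC.
Qed.

(** The symmetric difference is a function of the step whose derivative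
    is a first difference of the derivative of [f], hence linear in the step up to a small
    error; the mean value inequality integrates this estimate. *)
Lemma second_difference f v g q : unif_derive f v g -> unif_derive g v q ->
  forall e : R, 0 < e -> exists2 d : R, 0 < d & forall x (h : R), 0 < h < d ->
    `|f (x + h *: v) + f (x - h *: v) - 2 * f x - h ^+ 2 * q x| <= e * h ^+ 2.
Proof.
move=> fg gq e e0.
have [d d0 H] := gq _ (divr_gt0 e0 (ltr0Sn _ 1)).
exists d => // x h /andP[h0 hd].
pose F t := f (x + t *: v) + f (x + t *: (- 1 *: v)) + - q x * t ^+ 2.
pose F' t := g (x + t *: v) + -1 * g (x + t *: (- 1 *: v)) + - q x * (2 * t).
have FF : primitive_on 0 h F' F.
  move=> t _; apply: is_deriveD.
    apply: is_deriveD; first exact: unif_derive_line.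
    exact: unif_derive_line (unif_derive_scale (-1) fg).
  have D : is_derive t 1 (fun s : R => s ^+ 2) (2 * t).
    have := @exprn_derivable R 2 t 1; move/derivableP.
    by rewrite exp_derive expr1 [_ *: (1:R)]mulr1.
  exact: (@is_deriveZ _ _ _ (fun s : R => s ^+ 2) (- q x) t 1 _ D).
have := primitive_dist (ltW h0) FF (c := 0) (d := e * h).
have bd t : 0 <= t <= h -> `|F' t - 0| <= e * h.
  move=> /andP[t0 th].
  have tn : `|t| <= h by rewrite ger0_norm.
  have E1 := H x t (le_lt_trans tn hd).
  have Nt : `|- t| < d by rewrite normrN (le_lt_trans tn).
  have E2 := H x (- t) Nt; rewrite normrN in E2.
  have -> : F' t - 0 = (g (x + t *: v) - g x - t * q x) -
      (g (x + - t *: v) - g x - - t * q x).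
    by rewrite /F' scalerA mulrN1; ring.
  apply: le_trans (ler_normB _ _) _; apply: le_trans (lerD E1 E2) _.
  by rewrite -mulrDl -splitr ler_wpM2l// ltW.
move=> /(_ bd); rewrite /F.
rewrite !scale0r !addr0 expr0n mulr0 addr0 mul0r !subr0 scalerA mulrN1 scaleNr.
rewrite (_ : _ - _ = f (x + h *: v) + f (x - h *: v) - 2 * f x - h ^+ 2 * q x); last by ring.
by rewrite expr2 mulrA.
Qed.

End Taylor.

(** * Square-root decomposition and combinations of translations *)

Section PSD.
Variables (R : realType) (n : nat).

Lemma dot_delta_mulmx (S : 'M[R]_n) i j :
  dot (delta_mx i 0) (S *m delta_mx j 0) = S i j.
Proof.
rewrite -colE /dot (bigD1 i)//= !mxE !eqxx mul1r big1 ?addr0// => l /negPf li.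
by rewrite !mxE li mul0r.
Qed.

Lemma dot_mulmx_sym (S : 'M[R]_n) x y : S^T = S -> dot x (S *m y) = dot y (S *m x).
Proof.
move=> St.
have E u v : dot u (S *m v) = (u^T *m S *m v) 0 0.
  by rewrite -mulmxA [RHS]mxE; apply: eq_bigr => i _; rewrite [u^T _ _]mxE.
by rewrite !E -[in RHS]St -[in RHS](trmxK x) -!trmx_mul mulmxA [RHS]mxE.
Qed.

(** Gaussian elimination.  If the pivot is positive, subtracting the
    square of the scaled pivot column clears its row, and what remains is
    nonnegative because it is the minimum of the form over translations along the pivot
    direction; if the pivot vanishes, nonnegativity forces its row to vanish. *)
Lemma nonneg_definite_decomp (S : 'M[R]_n) : nonneg_definite S ->
  exists ss : seq 'cV[R]_n, forall i j, S i j = \sum_(s <- ss) s i 0 * s j 0.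
Proof.
suff H m : forall S : 'M[R]_n, nonneg_definite S ->
    (forall i j : 'I_n, (m <= i)%N -> S i j = 0) ->
    exists ss : seq 'cV[R]_n, forall i j, S i j = \sum_(s <- ss) s i 0 * s j 0.
  by move=> Spd; apply: (H n) => // i j; rewrite leqNgt ltn_ord.
elim: m => [|m IH] {}S [St Sp] S0.
  by exists [::] => i j; rewrite big_nil S0.
have [mn|nm] := ltnP m n; last first.
  apply: IH => // i j mi; have := ltn_ord i.
  by rewrite ltnNge (leq_trans nm mi).
pose o := Ordinal mn.
have Ssym i j : S i j = S j i by rewrite -[in LHS]St mxE.
have quad x y : dot (x + y) (S *m (x + y)) =
    dot x (S *m x) + 2 * dot x (S *m y) + dot y (S *m y).
  rewrite mulmxDr !(dotDl, dotDr) (dot_mulmx_sym y x St); ring.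
pose e : 'cV[R]_n := delta_mx o 0.
have qe : dot e (S *m e) = S o o by rewrite dot_delta_mulmx.
have a0 : 0 <= S o o by rewrite -qe.
have [az|anz] := eqVneq (S o o) 0.
  apply: IH => // i j; rewrite leq_eqVlt => /orP[/eqP mi|]; last exact: S0.
  have -> : i = o by apply/val_inj.
  have P t : 0 <= S j j + 2 * t * S o j.
    have := Sp (delta_mx j 0 + t *: e).
    rewrite quad -scalemxAr !(dotZl, dotZr) qe az !dot_delta_mulmx (Ssym j o); lra.
  have [//|s0] := eqVneq (S o j) 0.
  (* a nonconstant affine function of t takes the value -1 *)
  have := P (- (S j j + 1) / (2 * S o j)).
  rewrite (_ : _ + _ = -1); first by lra.
  by field.
pose c := S *m e.
have cE i : c i 0 = S i o by rewrite /c -colE mxE.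
pose s := (Num.sqrt (S o o))^-1 *: c.
have ss i j : s i 0 * s j 0 = S i o * S j o / S o o.
  rewrite ![s _ _]mxE !cE -{3}(sqr_sqrtr a0).
  by field; rewrite sqrtr_eq0 -ltNge lt0r anz.
have [|i j mi|l lE] := IH (S - \matrix_(i, j) (S i o * S j o / S o o)).
- split.
    by apply/matrixP => i j; rewrite !mxE (Ssym j i) [S j o * _]mulrC.
  move=> x; rewrite mulmxBl dotDr dotNr.
  have -> : dot x ((\matrix_(i, j) (S i o * S j o / S o o)) *m x) =
     dot x c ^+ 2 / S o o.
    rewrite expr2 -mulrA /dot mulr_suml; apply: eq_bigr => i _.
    rewrite cE [(_ *m _) _ _]mxE -mulrA; congr (_ * _).
    rewrite mulr_suml mulr_sumr; apply: eq_bigr => j _.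
    by rewrite cE !mxE; ring.
  have := Sp (x + (- (dot x c / S o o)) *: e).
  rewrite quad -scalemxAr !(dotZl, dotZr) qe -/c.
  by congr (0 <= _); field.
- rewrite !mxE; have := mi; rewrite leq_eqVlt => /orP[/eqP mio|mio].
    have -> : i = o by apply/val_inj.
    by rewrite (Ssym j o); field.
  by rewrite (S0 i j mio) (S0 i o mio) !mul0r subrr.
exists (s :: l) => i j; rewrite big_cons -lE ss !mxE; ring.
Qed.

End PSD.

Section ShiftOperators.
Variables (R : realType) (k : nat).
Notation V := 'cV[R]_k.
Implicit Types (A B : seq (R * V)) (f g : V -> R).

(** Finite combinations of translations.  Being finite, they act on derivatives
    of any order and commute with averaging operators without convergence
    questions. *)
Definition shiftop A f x : R := \sum_(a <- A) a.1 * f (x + a.2).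
Definition mass A : R := \sum_(a <- A) a.1.
Definition nneg A := forall a, a \in A -> 0 <= a.1.

Lemma shiftop_lin A c f g x :
  shiftop A (fun y => f y + c * g y) x = shiftop A f x + c * shiftop A g x.
Proof.
rewrite /shiftop mulr_sumr -big_split; apply: eq_bigr => a _ /=; ring.
Qed.

Lemma shiftop_cst A c x : shiftop A (fun=> c) x = mass A * c.
Proof. by rewrite /shiftop -mulr_suml. Qed.

Lemma shiftop_le A f g x : nneg A -> (forall y, f y <= g y) ->
  shiftop A f x <= shiftop A g x.
Proof.
move=> A0 fg; rewrite /shiftop big_seq [leRHS]big_seq.
by apply: ler_sum => a aA; rewrite ler_wpM2l ?A0.
Qed.

Lemma mass_ge0 A : nneg A -> 0 <= mass A.
Proof. by move=> A0; rewrite /mass big_seq sumr_ge0. Qed.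

Lemma shiftop_dist A f g c x : nneg A -> (forall y, `|f y - g y| <= c) ->
  `|shiftop A f x - shiftop A g x| <= mass A * c.
Proof.
move=> A0 H; rewrite -(shiftop_cst A c x).
rewrite ler_norml; apply/andP; split.
  have := @shiftop_le A (fun y => g y + (-1) * c) f x A0.
  rewrite shiftop_lin => h; have : shiftop A g x + -1 * shiftop A (fun=> c) x <= shiftop A f x.
    by apply: h => y; have := H y; rewrite ler_norml; lra.
  by lra.
have := @shiftop_le A f (fun y => g y + 1 * c) x A0.
rewrite shiftop_lin => h; have : shiftop A f x <= shiftop A g x + 1 * shiftop A (fun=> c) x.
  by apply: h => y; have := H y; rewrite ler_norml; lra.
by lra.
Qed.

Definition compose A B := [seq (a.1 * b.1, a.2 + b.2) | a <- A, b <- B].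

Lemma shiftop_compose A B f x :
  shiftop (compose A B) f x = shiftop A (shiftop B f) x.
Proof.
rewrite /shiftop /compose big_allpairs_dep/=; apply: eq_bigr => a _.
by rewrite mulr_sumr; apply: eq_bigr => c _; rewrite mulrA addrA.
Qed.

Lemma mass_compose A B : mass (compose A B) = mass A * mass B.
Proof.
have := shiftop_compose A B (fun=> 1) 0; rewrite shiftop_cst mulr1 => ->.
rewrite (_ : shiftop B _ = fun=> mass B) ?shiftop_cst//.
by apply/funext => y; rewrite shiftop_cst mulr1.
Qed.

Lemma nneg_compose A B : nneg A -> nneg B -> nneg (compose A B).
Proof. by move=> A0 B0 _ /allpairsP[[a c] /= [aA cB ->]] /=; apply: mulr_ge0; [exact: A0|exact: B0]. Qed.

Lemma shiftop_cons a A f x :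
  shiftop (a :: A) f x = shiftop A f x + a.1 * f (x + a.2).
Proof. by rewrite /shiftop big_cons addrC. Qed.

Lemma shiftop_nilE : @shiftop [::] = fun f x => 0.
Proof. by apply/funext => f; apply/funext => x; rewrite /shiftop big_nil. Qed.

Lemma shiftop_consE a A :
  @shiftop (a :: A) = fun f x => shiftop A f x + a.1 * f (x + a.2).
Proof. by apply/funext => f; apply/funext => x; exact: shiftop_cons. Qed.

Lemma shiftop_BUC A f : BUC f -> BUC (shiftop A f).
Proof.
move=> fB; elim: A => [|a A IH].
  by rewrite shiftop_nilE; exact: BUC_cst.
by rewrite shiftop_consE; apply: BUC_lin => //; exact: BUC_shift.
Qed.

Lemma shiftop_unif_derive A f v g : unif_derive f v g -> unif_derive (shiftop A f) v (shiftop A g).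
Proof.
move=> fg; elim: A => [|a A IH].
  rewrite shiftop_nilE => e e0; exists 1 => // x t _.
  by rewrite mulr0 !subr0 normr0 mulr_ge0// ltW.
by rewrite !shiftop_consE; apply: unif_derive_lin => //; exact: unif_derive_shift.
Qed.

Lemma shiftop_BUC2 A f (g : 'I_k -> V -> R) H : BUC2 f g H ->
  BUC2 (shiftop A f) (fun i => shiftop A (g i)) (fun i j => shiftop A (H i j)).
Proof.
by case=> *; split=> *; (exact: shiftop_BUC || exact: shiftop_unif_derive).
Qed.

Lemma averaging_shiftop rho M A f x : averaging rho M -> BUC f ->
  M (shiftop A f) x = shiftop A (M f) x.
Proof.
move=> MA fB; elim: A => [|a A IH].
  by rewrite !shiftop_nilE (avg_cst MA).
rewrite !shiftop_consE (avg_lin MA) ?IH ?(avg_shift MA)//.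
  exact: shiftop_BUC.
exact: BUC_shift.
Qed.

End ShiftOperators.

(** * Finite differences for the diffusion operator *)

Section Generator.
Variables (R : realType) (k : nat).
Notation V := 'cV[R]_k.
Variables (Sigma : 'M[R]_k) (b : V).
Implicit Types (f : V -> R) (g : 'I_k -> V -> R) (H : 'I_k -> 'I_k -> V -> R).

(** The operator L evaluated on prescribed first and second derivatives. *)
Definition jetL g H x : R :=
  - (2^-1 * \sum_i \sum_j Sigma i j * H j i x) - \sum_i b i 0 * g i x.

Lemma jetL_lin g H g' H' c x :
  jetL (fun i y => g i y + c * g' i y) (fun i j y => H i j y + c * H' i j y) x =
  jetL g H x + c * jetL g' H' x.
Proof.
rewrite /jetL.
have -> : \sum_i \sum_j Sigma i j * (H j i x + c * H' j i x) =
   \sum_i \sum_j Sigma i j * H j i x + c * \sum_i \sum_j Sigma i j * H' j i x.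
  rewrite mulr_sumr -big_split; apply: eq_bigr => i _ /=.
  by rewrite mulr_sumr -big_split; apply: eq_bigr => j _ /=; ring.
have -> : \sum_i b i 0 * (g i x + c * g' i x) =
   \sum_i b i 0 * g i x + c * \sum_i b i 0 * g' i x.
  by rewrite mulr_sumr -big_split; apply: eq_bigr => i _ /=; ring.
by ring.
Qed.

Lemma jetL_shiftop A g H x :
  jetL (fun i => shiftop A (g i)) (fun i j => shiftop A (H i j)) x =
  shiftop A (jetL g H) x.
Proof.
elim: A => [|a A IH].
  rewrite !shiftop_nilE /jetL !big1 ?mulr0 ?oppr0 ?addr0// => i _.
    by rewrite mulr0.
  by rewrite big1// => j _; rewrite mulr0.
by rewrite !shiftop_consE jetL_lin IH.
Qed.

Lemma BUC_sum (I : Type) (s : seq I) (c : I -> R) (F : I -> V -> R) :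
  (forall i, BUC (F i)) -> BUC (fun x => \sum_(i <- s) c i * F i x).
Proof.
move=> FB; elim: s => [|i s IH].
  by under eq_fun do rewrite big_nil; exact: BUC_cst.
by under eq_fun do rewrite big_cons addrC; exact: BUC_lin.
Qed.

Lemma jetL_BUC f g H : BUC2 f g H -> BUC (jetL g H).
Proof.
case=> _ _ gB _ HB.
have B1 := @BUC_sum _ (index_enum 'I_k) (fun i => b i 0) g gB.
have B2 : BUC (fun x => \sum_i 1 * (\sum_j Sigma i j * H j i x)).
  by apply: BUC_sum => i; apply: BUC_sum.
have := BUC_lin (- 2^-1) (BUC_lin (-1) (BUC_cst k 0) B1) B2.
congr BUC; apply/funext => x; rewrite /jetL.
under [X in _ + _ * X]eq_bigr do rewrite mul1r.
by ring.
Qed.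

Variable ss : seq V.
Hypothesis SigmaE : forall i j, Sigma i j = \sum_(s <- ss) s i 0 * s j 0.

(** Unnormalised transition weights of a random walk: steps of size [h] in the
    directions of [ss] with either sign, and a drift step of size [h ^+ 2]. *)
Definition walk (h : R) : seq (R * V) :=
  foldr (fun s A => [:: (2^-1, h *: s), (2^-1, - (h *: s)) & A])
    [:: (1, h ^+ 2 *: b)] ss.

Lemma walk_nneg h : nneg (walk h).
Proof.
rewrite /walk; elim: ss => [|s l IH] a /=; rewrite !inE.
  by move=> /eqP ->.
by move=> /or3P[/eqP -> //=|/eqP -> //=|/IH].
Qed.

Lemma shiftop_walk h f x : shiftop (walk h) f x =
  f (x + h ^+ 2 *: b) +
  \sum_(s <- ss) 2^-1 * (f (x + h *: s) + f (x - h *: s)).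
Proof.
rewrite /walk; elim: ss => [|s l IH] /=.
  by rewrite /shiftop big_seq1 big_nil mul1r addr0.
by rewrite 2!shiftop_cons IH big_cons /=; ring.
Qed.

Let mu : R := (size ss).+1%:R.

Lemma mass_walk h : mass (walk h) = mu.
Proof.
have := shiftop_walk h (fun=> 1) 0; rewrite shiftop_cst mulr1 => ->.
under eq_bigr do rewrite mulVf//.
by rewrite big_const_seq iter_addr_0 count_predT nat1r.
Qed.

Definition difference_op h f x : R := (h ^+ 2)^-1 * (mu * f x - shiftop (walk h) f x).

(** The diffusion steps see second differences along the vectors of the
    decomposition, whose sum is the trace term; the drift step, of size
    [h ^+ 2], sees the first-order term. *)
Lemma consistency f g H : BUC2 f g H -> forall e : R, 0 < e ->
  exists2 h0 : R, 0 < h0 & forall h x, 0 < h < h0 ->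
    `|difference_op h f x - jetL g H x| <= e.
Proof.
move=> C e e0.
have dir (v : V) : unif_derive f v (fun x => \sum_i v i 0 * g i x).
  by apply: unif_derive_dir; [exact: BUC2_grad C | move=> i; have [] := BUC2_gradB C i].
have dirg (v : V) i : unif_derive (g i) v (fun x => \sum_j v j 0 * H j i x).
  apply: unif_derive_dir => j; first exact: (BUC2_hess C).
  by have [] := BUC2_hessB C j i.
pose q (s : V) x := \sum_i s i 0 * \sum_j s j 0 * H j i x.
have second (s : V) : forall e : R, 0 < e -> exists2 d : R, 0 < d &
    forall x (h : R), 0 < h < d ->
    `|f (x + h *: s) + f (x - h *: s) - 2 * f x - h ^+ 2 * q s x| <= e * h ^+ 2.
  apply: (second_difference (dir s)); exact: unif_derive_sum.
have e2 : 0 < e / 2 by rewrite divr_gt0.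
have [d d0 drift] := dir b _ e2.
have [d1 d10 diffusion] : exists2 d1 : R, 0 < d1 & forall x (h : R), 0 < h < d1 ->
   `|\sum_(s <- ss) (f (x + h *: s) + f (x - h *: s) - 2 * f x) -
     h ^+ 2 * \sum_(s <- ss) q s x| <= e / 2 * h ^+ 2.
  elim: (ss) (e / 2) e2 => [|s l IH] a a0.
    exists 1 => // x h _; rewrite !big_nil mulr0 subr0 normr0.
    by rewrite mulr_ge0 ?sqr_ge0 ?ltW.
  have a2 : 0 < a / 2 by rewrite divr_gt0.
  have [d1 d10 H1] := IH _ a2; have [d2 d20 H2] := second s _ a2.
  exists (Num.min d1 d2); first by rewrite lt_min d10.
  move=> x h; rewrite lt_min => /and3P[h0 hd1 hd2].
  have {}H1 := H1 x h; have {}H2 := H2 x h; rewrite h0 hd1 in H1; rewrite h0 hd2 in H2.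
  have {}H1 := H1 isT; have {}H2 := H2 isT.
  rewrite !big_cons; set Q := \sum_(s <- l) q _ _ in H1 *; set S := \sum_(s <- l) _ in H1 *.
  set D := f (x + h *: s) + f (x - h *: s) - 2 * f x in H2 *.
  rewrite (_ : D + S - _ = (D - h ^+ 2 * q s x) + (S - h ^+ 2 * Q)); last by ring.
  by apply: le_trans (ler_normD _ _) _; rewrite (splitr a) mulrDl; exact: lerD.
exists (Num.min 1 (Num.min d d1)).
  by rewrite !lt_min ltr01 d0.
move=> h x; rewrite !lt_min => /and4P[h0 h1 hd hd1].
have h20 : 0 < h ^+ 2 by rewrite exprn_gt0.
have h2d : `|h ^+ 2| < d.
  by rewrite ger0_norm ?sqr_ge0// (le_lt_trans _ hd)// expr2 ler_piMr// ltW.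
have {}drift := drift x _ h2d; rewrite (gtr0_norm h20) in drift.
have {}diffusion := diffusion x h; rewrite h0 hd1 in diffusion.
have {}diffusion := diffusion isT.
have E1 : jetL g H x = - (2^-1 * \sum_(s <- ss) q s x) - \sum_i b i 0 * g i x.
  rewrite /jetL; congr (- (_ * _) - _).
  under eq_bigr do under eq_bigr do rewrite SigmaE mulr_suml.
  under eq_bigr do rewrite exchange_big.
  rewrite exchange_big; apply: eq_bigr => s _ /=; apply: eq_bigr => i _.
  by rewrite mulr_sumr; apply: eq_bigr => j _; rewrite mulrA.
have E2 : mu * f x - shiftop (walk h) f x = - (f (x + h ^+ 2 *: b) - f x)
   - 2^-1 * \sum_(s <- ss) (f (x + h *: s) + f (x - h *: s) - 2 * f x).
  rewrite shiftop_walk sumrB big_const_seq iter_addr_0 count_predT /mu.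
  by rewrite -mulr_sumr -nat1r -[_ *+ size ss]mulr_natr; field.
rewrite /difference_op E1 E2.
set D := f (x + _) - f x in drift *; set G := \sum_i _ in drift *.
set Q := \sum_(s <- ss) q _ _ in diffusion *; set S := \sum_(s <- ss) _ in diffusion *.
have -> : (h ^+ 2)^-1 * (- D - 2^-1 * S) - (- (2^-1 * Q) - G) =
  - (D - h ^+ 2 * G + 2^-1 * (S - h ^+ 2 * Q)) / h ^+ 2.
  by field; rewrite gt_eqF.
rewrite normf_div normrN (gtr0_norm h20) ler_pdivrMr//.
apply: le_trans (ler_normD _ _) _; rewrite normrM (@ger0_norm _ 2^-1)//.
have : 0 <= `|S - h ^+ 2 * Q| by []; lra.
Qed.

Definition sqdist (x y : V) : R := dot (y - x) (y - x).

(** The squared distance is a Lyapunov function.  Applied to it, the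
    resolvent bounds its own second moment, which is how the weights are seen to
    concentrate at the origin when [lam] is large. *)
Lemma difference_op_sqdist : exists2 C, 0 <= C & forall h x y, 0 < h <= 1 ->
  - sqdist x y - C <= difference_op h (sqdist x) y.
Proof.
exists (2 * dot b b + \sum_(s <- ss) dot s s).
  by rewrite addr_ge0 ?mulr_ge0 ?dot_ge0// sumr_ge0// => s _; exact: dot_ge0.
move=> h x y /andP[h0 h1].
have h20 : 0 < h ^+ 2 by rewrite exprn_gt0.
have sqdD z : sqdist x (y + z) = sqdist x y + 2 * dot (y - x) z + dot z z.
  by rewrite /sqdist addrAC !(dotDl, dotDr) !(dotNl, dotNr) (dotC z x) (dotC z y); ring.
have -> : difference_op h (sqdist x) y =
   - 2 * dot (y - x) b - h ^+ 2 * dot b b - \sum_(s <- ss) dot s s.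
  rewrite /difference_op shiftop_walk.
  under eq_bigr do rewrite !sqdD -scaleNr !(dotZl, dotZr).
  rewrite (eq_bigr (fun s => h ^+ 2 * dot s s + 1 * sqdist x y)); last by move=> s _; field.
  rewrite big_split/= -!mulr_sumr big_const_seq iter_addr_0 count_predT sqdD !(dotZl, dotZr) /mu -nat1r.
  by rewrite -[_ *+ size ss]mulr_natr; field; rewrite gt_eqF.
have := dot2_upper (y - x) b; rewrite -/(sqdist x y).
have : h ^+ 2 * dot b b <= dot b b.
  by rewrite ler_piMl ?dot_ge0// expr_le1// ltW.
lra.
Qed.

End Generator.

(** * Approximate resolvent *)

Section Resolvent.
Variables (R : realType) (k : nat).
Notation V := 'cV[R]_k.
Variables (Sigma : 'M[R]_k) (b : V) (ss : seq V).
Hypothesis SigmaE : forall i j, Sigma i j = \sum_(s <- ss) s i 0 * s j 0.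
Implicit Types (f : V -> R) (g : 'I_k -> V -> R) (H : 'I_k -> 'I_k -> V -> R).

Let mu : R := (size ss).+1%:R.

(** Up to the factor [lam + mu / h ^+ 2], the discretised operator is the
    identity minus a substochastic average, so a truncated Neumann series inverts it; [B] is the
    remainder. *)
Lemma diff_resolvent (lam h : R) (n : nat) : 0 < lam -> 0 < h ->
  exists A B : seq (R * V), [/\ nneg A, nneg B,
    forall f x, shiftop A (fun y => lam * f y + difference_op b ss h f y) x =
      f x - shiftop B f x &
    mass B = (mu / (h ^+ 2 * lam + mu)) ^+ n].
Proof.
move=> lam0 h0.
have mu0 : 0 < mu by rewrite ltr0Sn.
have h20 : 0 < h ^+ 2 by rewrite exprn_gt0.
have D0 : 0 < h ^+ 2 * lam + mu by rewrite addr_gt0 ?mulr_gt0.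
pose one : seq (R * V) := [:: ((h ^+ 2 * lam + mu)^-1, 0)].
pose E := compose one (walk b ss h).
have one0 : nneg one by move=> a; rewrite inE => /eqP ->; rewrite invr_ge0 ltW.
have E0 : nneg E by apply: nneg_compose => //; exact: walk_nneg.
have EE f x : shiftop E f x = (h ^+ 2 * lam + mu)^-1 * shiftop (walk b ss h) f x.
  by rewrite shiftop_compose [LHS]/shiftop big_seq1 addr0.
elim: n => [|n [A [B [A0 B0 AB mB]]]].
  exists [::], [:: (1, 0)]; split => //.
  - by move=> a; rewrite inE => /eqP ->.
  - by move=> f x; rewrite /shiftop big_nil big_seq1 addr0 mul1r subrr.
  - by rewrite /mass big_seq1.
exists ((h ^+ 2 / (h ^+ 2 * lam + mu), 0) :: compose E A), (compose E B); split.
- move=> a; rewrite inE => /orP[/eqP -> /=|]; first by rewrite divr_ge0// ltW.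
  exact: nneg_compose.
- exact: nneg_compose.
- move=> f x; rewrite shiftop_cons !(shiftop_compose E) addr0 /=.
  rewrite (_ : shiftop A _ = fun y => f y + -1 * shiftop B f y); last first.
    by apply/funext => y; rewrite AB mulN1r.
  rewrite shiftop_lin mulN1r !EE /difference_op -/mu.
  by field; rewrite nat1r -/mu !gt_eqF.
- have -> : mass (compose E B) = mass E * mass B by exact: mass_compose.
  have -> : mass E = (h ^+ 2 * lam + mu)^-1 * mu.
    by rewrite mass_compose mass_walk /mass big_seq1.
  by rewrite mB [RHS]exprS; congr (_ * _); rewrite mulrC.
Qed.

(** The second moment is of order [lam ^- 2], with a constant that
    depends on neither [lam] nor the two functions.  Two functions are treated
    at once because the comparison function and the mollified solution have to
    share the same weights. *)
Lemma approx_resolvent : exists2 C : R, 0 <= C & forall lam : R, 1 < lam ->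
  forall f1 (g1 : 'I_k -> V -> R) H1 f2 (g2 : 'I_k -> V -> R) H2,
  BUC2 f1 g1 H1 -> BUC2 f2 g2 H2 -> forall e : R, 0 < e ->
  exists A, [/\ nneg A, 1 - e <= lam * mass A <= 1,
    forall x, lam * (lam - 1) * shiftop A (sqdist x) x <= C,
    forall x, `|shiftop A (fun y => lam * f1 y + jetL Sigma b g1 H1 y) x - f1 x| <= e &
    forall x, `|shiftop A (fun y => lam * f2 y + jetL Sigma b g2 H2 y) x - f2 x| <= e].
Proof.
have [C C0 HC] := difference_op_sqdist b ss; exists C => // lam lam1 f1 g1 H1 f2 g2 H2 F1 F2 e e0.
have lam0 : 0 < lam by lra.
have e2 : 0 < e / 2 by rewrite divr_gt0.
have [h1 h10 K1] := consistency b SigmaE F1 e2.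
have [h2 h20 K2] := consistency b SigmaE F2 e2.
have [h [h0 hh1 hh2 hle]] : exists h, [/\ 0 < h, h < h1, h < h2 & h <= 1].
  exists (Num.min 1 (Num.min h1 h2) / 2).
  have m0 : 0 < Num.min 1 (Num.min h1 h2) by rewrite !lt_min ltr01 h10.
  have m1 : Num.min 1 (Num.min h1 h2) <= 1 by rewrite ge_min lexx.
  have m2 : Num.min 1 (Num.min h1 h2) <= h1 by rewrite !ge_min lexx !orbT.
  have m3 : Num.min 1 (Num.min h1 h2) <= h2 by rewrite !ge_min lexx !orbT.
  by split; lra.
have [[B1 fB1] _] := BUC2_BUC F1; have [[B2 fB2] _] := BUC2_BUC F2.
have mu0 : 0 < mu by rewrite ltr0Sn.
pose th := mu / (h ^+ 2 * lam + mu).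
have D0 : 0 < h ^+ 2 * lam + mu by rewrite addr_gt0 ?mulr_gt0 ?exprn_gt0.
have th0 : 0 <= th by rewrite divr_ge0 ?ltW.
have th1 : th < 1 by rewrite ltr_pdivrMr// mul1r ltrDr mulr_gt0 ?exprn_gt0.
have M0 : 0 < 1 + `|B1| + `|B2| by rewrite !ltr_wpDr.
have [n thn] : exists n, th ^+ n <= e / 2 / (1 + `|B1| + `|B2|).
  have q0 : 0 < e / 2 / (1 + `|B1| + `|B2|) by rewrite divr_gt0.
  have := @cvg_expr R th; rewrite ger0_norm// => /(_ th1) /cvgrPdist_le /(_ _ q0).
  case=> N _ /(_ N (leqnn N)); rewrite sub0r normrN normrX ger0_norm//.
  by exists N.
have [A [B [A0 B0 AB mB]]] := diff_resolvent n lam0 h0.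
rewrite -/th in mB.
have thn0 : 0 <= th ^+ n by rewrite exprn_ge0.
have thne : th ^+ n * (1 + `|B1| + `|B2|) <= e / 2 by rewrite -ler_pdivlMr.
have massE : lam * mass A = 1 - th ^+ n.
  have := AB (fun=> 1) 0; rewrite shiftop_cst mB => E; rewrite -[th ^+ n]mulr1 -E.
  rewrite (_ : (fun y => _) = fun=> lam).
    by rewrite shiftop_cst mulrC.
  apply/funext => y; rewrite /difference_op shiftop_cst mass_walk mulr1.
  by rewrite subrr mulr0 addr0.
have mA0 := mass_ge0 A0.
have mA1 : mass A <= 1 by nra.
have approx f g H c : BUC2 f g H -> (forall x, `|f x| <= c) ->
    (forall x, `|difference_op b ss h f x - jetL Sigma b g H x| <= e / 2) ->
    c <= `|B1| + `|B2| ->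
    forall x, `|shiftop A (fun y => lam * f y + jetL Sigma b g H y) x - f x| <= e.
  move=> F fc K cB x.
  have E1 : `|shiftop B f x - shiftop B (fun=> 0) x| <= mass B * c.
    by apply: shiftop_dist => // y; rewrite subr0.
  rewrite shiftop_cst mulr0 subr0 mB in E1.
  have E2 : `|shiftop A (fun y => lam * f y + jetL Sigma b g H y) x -
      shiftop A (fun y => lam * f y + difference_op b ss h f y) x| <= mass A * (e / 2).
    apply: shiftop_dist => // y.
    by rewrite opprD addrACA subrr add0r distrC.
  rewrite AB in E2.
  have c0 : 0 <= c by apply: le_trans (fc 0).
  have E3 : th ^+ n * c <= th ^+ n * (1 + `|B1| + `|B2|).
    by rewrite ler_wpM2l//; lra.
  set S := shiftop A _ x in E2 *.
  rewrite (_ : S - f x = (S - (f x - shiftop B f x)) - shiftop B f x); last by ring.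
  by apply: le_trans (ler_normB _ _) _; nra.
exists A; split => //.
- rewrite massE; apply/andP; split; last by lra.
  have : th ^+ n <= th ^+ n * (1 + `|B1| + `|B2|).
    by rewrite ler_peMr// -addrA lerDl addr_ge0.
  by lra.
- move=> x.
  have S0 y : 0 <= sqdist x y by exact: dot_ge0.
  have : shiftop A (fun y => (lam - 1) * sqdist x y + (- C)) x <=
      shiftop A (fun y => lam * sqdist x y + difference_op b ss h (sqdist x) y) x.
    apply: shiftop_le => // y; have := HC h x y; rewrite h0 hle => /(_ isT).
    by rewrite -/(sqdist x y); lra.
  rewrite AB.
  have : 0 <= shiftop B (sqdist x) x.
    by have := shiftop_le x B0 S0; rewrite shiftop_cst mulr0.
  have -> : sqdist x x = 0 by rewrite /sqdist subrr dot0l.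
  have -> : shiftop A (fun y => (lam - 1) * sqdist x y + - C) x =
      - C * mass A + (lam - 1) * shiftop A (sqdist x) x.
    have := shiftop_lin A (lam - 1) (fun=> - C) (sqdist x) x.
    rewrite shiftop_cst [mass A * _]mulrC => <-; congr shiftop.
    by apply/funext => y; rewrite addrC.
  move=> P1 P2.
  have : (lam - 1) * shiftop A (sqdist x) x <= C * mass A by lra.
  move/(ler_wpM2l (ltW lam0)); rewrite !mulrA => /le_trans; apply.
  by rewrite mulrAC massE -[leRHS]mul1r ler_wpM2r//; lra.
- apply: (approx _ _ _ `|B1|) => //.
  + by move=> x; apply: le_trans (fB1 x) (ler_norm _).
  + by move=> x; apply: K1; rewrite h0.
  + by rewrite lerDl.
- apply: (approx _ _ _ `|B2|) => //.
  + by move=> x; apply: le_trans (fB2 x) (ler_norm _).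
  + by move=> x; apply: K2; rewrite h0.
  + by rewrite lerDr.
Qed.

End Resolvent.

(** * Compact sets and explicit second-order jets *)

Section ColCompact.
Variables (R : realType) (k : nat).
Notation V := 'cV[R]_k.

Lemma norm_trmx (x : V) : `|x^T| = `|x|.
Proof.
rewrite /Num.Def.normr/= !mx_normrE; apply/eqP; rewrite eq_le; apply/andP; split.
  apply: bigmax_le => [|[i j] _] /=; first exact: bigmax_ge_id.
  by rewrite mxE; exact: (le_bigmax _ (fun ij => `|x ij.1 ij.2|) (j, i)).
apply: bigmax_le => [|[i j] _] /=; first exact: bigmax_ge_id.
have := le_bigmax 0 (fun ij => `|x^T ij.1 ij.2|) (j, i).
by rewrite /= mxE.
Qed.

Lemma col_compact (A : set V) (B : R) : closed A -> (forall x, A x -> `|x| <= B) ->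
  compact A.
Proof.
move=> Acl AB.
have tr_cont : continuous (fun v : 'rV[R]_k => v^T : V).
  move=> v; apply/(@cvgrPdist_le _ _ _ (nbhs v) (nbhs_filter v)) => e e0.
  apply: filterS (@nbhsx_ballx _ 'rV[R]_k v e e0) => w.
  rewrite mx_norm_ball /ball_/= => vw.
  by rewrite -linearB /= -norm_trmx trmxK ltW.
have -> : A = (fun v : 'rV[R]_k => v^T : V) @` [set v : 'rV[R]_k | A v^T].
  apply/seteqP; split => [x Ax|x [v Av <-]//].
  by exists x^T; rewrite /= trmxK.
apply: continuous_compact; first exact: continuous_subspaceT.
apply: bounded_closed_compact.
  exists B; split; first exact: num_real.
  move=> M BM v /= Av; rewrite -(trmxK v) norm_trmx.
  exact: le_trans (AB _ Av) (ltW BM).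
exact: (@preimage_closed _ _ (fun v : 'rV[R]_k => v^T : V)).
Qed.

End ColCompact.

Section Jets.
Variables (R : realType) (k : nat).
Notation V := 'cV[R]_k.
Implicit Types (f : V -> R) (g : 'I_k -> V -> R) (H : 'I_k -> 'I_k -> V -> R).

(** The data of a test function: unlike [BUC2] it allows unbounded functions,
    such as linear ones and squared distances. *)
Record jet2 f g H : Prop := Jet2 {
  jet2_cont : continuous f;
  jet2_grad : forall i x, is_derive x (unit_vec R i) f (g i x);
  jet2_gradC : forall i, continuous (g i);
  jet2_hess : forall i j x, is_derive x (unit_vec R i) (g j) (H i j x);
  jet2_hessC : forall i j, continuous (H i j) }.

Lemma BUC2_jet2 f g H : BUC2 f g H -> jet2 f g H.
Proof.
case=> [[_ fU] fg gB gH HB]; split.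
- exact: unif_cont_continuous.
- by move=> i x; exact: unif_derive_is_derive.
- by move=> i; have [_] := gB i; exact: unif_cont_continuous.
- by move=> i j x; exact: unif_derive_is_derive.
- by move=> i j; have [_] := HB i j; exact: unif_cont_continuous.
Qed.

Lemma continuous_add f f' : continuous f -> continuous f' ->
  continuous (fun x => f x + f' x).
Proof. by move=> fC fC' x; exact: (@continuousD R R^o V f f' x (fC x) (fC' x)). Qed.

Lemma continuous_mul f f' : continuous f -> continuous f' ->
  continuous (fun x => f x * f' x).
Proof. by move=> fC fC' x; exact: (@continuousM R V f f' x (fC x) (fC' x)). Qed.

Lemma continuous_const (c : R) : continuous (fun _ : V => c).
Proof. exact: cst_continuous. Qed.

Lemma continuous_lin f f' c : continuous f -> continuous f' ->
  continuous (fun x => f x + c * f' x).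
Proof.
by move=> fC fC'; do ?[apply: continuous_add|apply: continuous_mul] => //; exact: continuous_const.
Qed.

Lemma continuous_sum (I : Type) (s : seq I) (F : I -> V -> R) :
  (forall i, continuous (F i)) -> continuous (fun x => \sum_(i <- s) F i x).
Proof.
move=> FC; elim: s => [|i s IH].
  by under eq_fun do rewrite big_nil; exact: continuous_const.
by under eq_fun do rewrite big_cons; exact: continuous_add.
Qed.

Lemma is_derive_lin f f' c (x v : V) (d d' : R) : is_derive x v f d -> is_derive x v f' d' ->
  is_derive x v (fun x => f x + c * f' x) (d + c * d').
Proof.
move=> D D'; apply: is_deriveD.
Qed.

Lemma jet2_lin f g H f' g' H' c : jet2 f g H -> jet2 f' g' H' ->
  jet2 (fun x => f x + c * f' x) (fun i x => g i x + c * g' i x)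
    (fun i j x => H i j x + c * H' i j x).
Proof.
case=> [a1 a2 a3 a4 a5] [b1 b2 b3 b4 b5]; split; move=> *;
  (exact: continuous_lin || exact: is_derive_lin).
Qed.

Lemma jet2_partial f g H i : jet2 f g H -> partial i f = g i.
Proof.
by move=> J; apply/funext => x; have [_] := jet2_grad J i x.
Qed.

Lemma jet2_partial2 f g H i j : jet2 f g H -> partial i (partial j f) = H i j.
Proof.
move=> J; rewrite (jet2_partial j J).
by apply/funext => x; have [_] := jet2_hess J i j x.
Qed.

Lemma jet2_C2_on f g H (S : set V) : jet2 f g H -> C2_on S f.
Proof.
move=> J; exists setT; split => //; first exact: openT.
move=> x _; split.
- exact: (jet2_cont J).
- by move=> i; have [] := jet2_grad J i x.
- by move=> i; rewrite (jet2_partial i J); exact: (jet2_gradC J).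
- by move=> i j; rewrite (jet2_partial j J); have [] := jet2_hess J i j x.
- by move=> i j; rewrite (jet2_partial2 i j J); exact: (jet2_hessC J).
Qed.

Lemma jet2_gradE f g H x : jet2 f g H -> grad f x = \col_i g i x.
Proof. by move=> J; apply/matrixP => i j; rewrite !mxE (jet2_partial i J). Qed.

Lemma jet2_calL (Sigma : 'M[R]_k) b f g H x : jet2 f g H ->
  calL Sigma b f x = jetL Sigma b g H x.
Proof.
move=> J; rewrite /calL /jetL (jet2_gradE x J); congr (- (_ * _) - _).
  rewrite /mxtrace; apply: eq_bigr => i _; rewrite mxE; apply: eq_bigr => j _.
  by rewrite mxE (jet2_partial2 j i J).
by apply: eq_bigr => i _; rewrite mxE.
Qed.

Lemma coord_continuous_col i : continuous (fun x : V => x i 0).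
Proof.
move=> x; apply/(@cvgrPdist_le _ _ _ (nbhs x) (nbhs_filter x)) => e e0.
apply: filterS (@nbhsx_ballx _ V x e e0) => y.
rewrite mx_norm_ball /ball_/= => /ltW; apply: le_trans.
by have := coord_le_norm (x - y) i; rewrite !mxE.
Qed.

Lemma is_derive_coord i v (x : V) : is_derive x v (fun y : V => y i 0) (v i 0).
Proof.
have cv : h^-1 *: ((h *: v + x) i 0 - x i 0) @[h --> 0^'] --> v i 0.
  apply/cvgrPdist_le => e e0; near=> h.
  have h0 : h != 0 by near: h; exact: nbhs_dnbhs_neq.
  rewrite !mxE addrK.
  rewrite (_ : h^-1 *: (h * v i 0) = v i 0); first by rewrite subrr normr0 ltW.
  by rewrite /GRing.scale/= mulrA mulVf// mul1r.
split; first by apply/cvg_ex; exists (v i 0).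
exact/cvg_lim.
Unshelve. all: by end_near. Qed.

Lemma jet2_dot (q : V) : jet2 (fun x => dot x q) (fun i _ => q i 0) (fun _ _ _ => 0).
Proof.
split; try by move=> *; (exact: cst_continuous || exact: is_derive_cst).
  apply: continuous_sum => i.
  by apply: continuous_mul; [exact: coord_continuous_col | exact: continuous_const].
move=> i x.
have := @is_derive_sum R V R k (fun j y => y j 0 * q j 0) x (unit_vec R i)
   (fun j => unit_vec R i j 0 * q j 0).
rewrite [X in is_derive _ _ _ X](bigD1 i)//= [X in _ + X]big1 => [|j /negPf ji]; last first.
  by rewrite /unit_vec mxE ji mul0r.
rewrite /unit_vec mxE !eqxx mul1r addr0 => D.
have -> : (fun y : V => dot y q) = \sum_(j < k) (fun y : V => y j 0 * q j 0).
  by apply/funext => y; rewrite fct_sumE.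
apply: D => j.
have D1 := is_derive_coord j (unit_vec R i) x.
have := @is_deriveZ R V R (fun y : V => y j 0) (q j 0) x (unit_vec R i) _ D1.
rewrite [_ *: _]mulrC.
by congr (is_derive _ _ _ _); apply/funext => y; rewrite /= mulrC.
Qed.

Lemma jet2_sqdist (x0 : V) : jet2 (sqdist x0) (fun i y => 2 * (y i 0 - x0 i 0))
  (fun i j _ => 2 * (i == j)%:R).
Proof.
have cC i : continuous (fun y : V => y i 0 - x0 i 0).
  by apply: continuous_add; [exact: coord_continuous_col | exact: continuous_const].
have cD i j x : is_derive x (unit_vec R j) (fun y : V => y i 0 - x0 i 0) (i == j)%:R.
  have := @is_deriveB _ _ _ (fun y : V => y i 0) (cst (x0 i 0)) x (unit_vec R j) _ _
    (is_derive_coord i _ x) (is_derive_cst _ _ _).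
  by rewrite mxE eqxx andbT subr0.
have sqE : sqdist x0 = \sum_(j < k) (fun y : V => (y j 0 - x0 j 0) * (y j 0 - x0 j 0)).
  apply/funext => y; rewrite fct_sumE /sqdist /dot.
  by apply: eq_bigr => i _; rewrite !mxE.
split.
- apply: continuous_sum => i.
  by under eq_fun do rewrite !mxE; apply: continuous_mul; exact: cC.
- move=> i x; rewrite sqE.
  have D j : is_derive x (unit_vec R i) (fun y : V => (y j 0 - x0 j 0) * (y j 0 - x0 j 0))
      (2 * ((j == i)%:R * (x j 0 - x0 j 0))).
    apply: (is_derive_eq (is_deriveM (cD j i x) (cD j i x))).
    by rewrite /GRing.scale/=; ring.
  have := is_derive_sum D.
  rewrite [X in is_derive _ _ _ X](bigD1 i)//= eqxx mul1r [X in _ + X]big1 ?addr0//.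
  by move=> j /negPf ji; rewrite ji mul0r mulr0.
- by move=> i; apply: continuous_mul; [exact: continuous_const | exact: cC].
- move=> i j x; rewrite eq_sym.
  exact: (@is_deriveZ _ _ _ (fun y : V => y j 0 - x0 j 0) 2 x _ _ (cD j i x)).
- by move=> *; exact: cst_continuous.
Qed.

Lemma jetL_sqdist (Sigma : 'M[R]_k) b (x0 y : V) :
  jetL Sigma b (fun i y => 2 * (y i 0 - x0 i 0)) (fun i j _ => 2 * (i == j)%:R) y =
  - \tr Sigma - 2 * dot b (y - x0).
Proof.
rewrite /jetL; congr (_ - _).
  congr (- _); rewrite mulr_sumr; apply: eq_bigr => i _.
  rewrite (bigD1 i)//= eqxx big1 ?addr0 => [|j /negPf ji]; last by rewrite ji !mulr0.
  by rewrite mulr1; field.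
by rewrite mulr_sumr; apply: eq_bigr => i _; rewrite !mxE; ring.
Qed.

Lemma jetL_dot (Sigma : 'M[R]_k) b (q y : V) :
  jetL Sigma b (fun i _ => q i 0) (fun _ _ _ => 0) y = - dot b q.
Proof.
rewrite /jetL big1 ?mulr0 ?oppr0 ?add0r// => i _.
by rewrite big1// => j _; rewrite mulr0.
Qed.

End Jets.

(** * Mollification of linear viscosity subsolutions *)

Section QuadraticModulus.
Variables (R : realType) (k : nat).
Notation V := 'cV[R]_k.
Implicit Types (f : V -> R).

Lemma norm_le_dot (x : V) (r : R) : 0 <= r -> dot x x <= r ^+ 2 -> `|x| <= r.
Proof.
move=> r0 xr; apply: le_trans (norm_le_enorm x) _.
by rewrite -[leRHS]ger0_norm// -sqrtr_sqr ler_sqrt// sqr_ge0.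
Qed.

(** A modulus of this form can be integrated against weights of which only
    mass and second moment are known. *)
Lemma BUC_quadratic_modulus f : BUC f -> forall e : R, 0 < e ->
  exists2 K : R, 0 <= K & forall x y, `|f y - f x| <= e + K * sqdist x y.
Proof.
move=> [[B fB] fU] e e0; have [d d0 H] := fU _ e0.
have B0 : 0 <= B by exact: le_trans (fB 0).
have d20 : 0 < d ^+ 2 by rewrite exprn_gt0.
exists (2 * B / d ^+ 2); first by rewrite divr_ge0 ?mulr_ge0// ltW.
move=> x y; have S0 : 0 <= sqdist x y by exact: dot_ge0.
have K0 : 0 <= 2 * B / d ^+ 2 by rewrite divr_ge0 ?mulr_ge0// ltW.
have [yd|dy] := ltP `|y - x| d.
  have := H x (y - x) yd; rewrite [x + _]addrC subrK => h.
  by rewrite -[leLHS]addr0 lerD// mulr_ge0.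
have : d ^+ 2 <= sqdist x y.
  apply: le_trans (norm_sqr_le_dot _).
  by rewrite lerXn2r ?nnegrE// ltW.
move/(ler_wpM2l K0); rewrite divfK ?gt_eqF// => h.
have := ler_normB (f y) (f x); have := fB x; have := fB y; lra.
Qed.

Lemma shiftop_osc (A : seq (R * V)) f e K x : nneg A ->
  (forall y, `|f y - f x| <= e + K * sqdist x y) ->
  `|shiftop A f x - mass A * f x| <= e * mass A + K * shiftop A (sqdist x) x.
Proof.
move=> A0 H.
have E : shiftop A (fun y => e + K * sqdist x y) x = e * mass A + K * shiftop A (sqdist x) x.
  by have := shiftop_lin A K (fun=> e) (sqdist x) x; rewrite shiftop_cst [mass A * e]mulrC.
have L : shiftop A (fun y => f y + -1 * f x) x = shiftop A f x - mass A * f x.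
  by rewrite (shiftop_lin A (-1) f (fun=> f x)) shiftop_cst mulN1r.
rewrite -L -E ler_norml; apply/andP; split.
  have := @shiftop_le _ _ A (fun y => 0 + -1 * (e + K * sqdist x y)) (fun y => f y + -1 * f x) x A0.
  rewrite (shiftop_lin A (-1) (fun=> 0)) shiftop_cst mulr0 add0r => h; rewrite -[X in X <= _]mulN1r; apply: h => y.
  by have := H y; rewrite ler_norml; lra.
by apply: shiftop_le => // y; have := H y; rewrite ler_norml; lra.
Qed.

End QuadraticModulus.

Definition linear_subsolution (R : realType) (k : nat) (Sigma : 'M[R]_k) (b : 'cV[R]_k)
    (beta : R) (f u : 'cV[R]_k -> R) (O : set 'cV[R]_k) : Prop :=
  forall x phi, O x -> C2_on O phi ->
    (forall y, O y -> u y - phi y <= u x - phi x) ->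
    beta * u x + calL Sigma b phi x <= f x.

(** The barrier [c |x - x0|^2] localises the maximum of [u - w] to the ball
    where the equation is known.  It perturbs the equation by a multiple of [eta],
    which bounds the distance between [u] and [w] and is small when [w] is a
    resolvent of [u]. *)
Lemma barrier_comparison (R : realType) (k : nat) (Sigma : 'M[R]_k) (b : 'cV[R]_k)
    (beta : R) (f u : 'cV[R]_k -> R) (O : set 'cV[R]_k)
    (n eta e rho : R) (w : 'cV[R]_k -> R) (g : 'I_k -> 'cV[R]_k -> R) H x0 :
  BUC u -> linear_subsolution Sigma b beta f u O -> 0 <= beta -> 0 <= n -> 0 <= eta -> 0 < rho -> BUC2 w g H ->
  (forall z, `|z| <= rho -> O (x0 + z)) ->
  (forall x, `|u x - w x| <= eta) ->
  (forall x, f x + n * u x <= (n + beta) * w x + jetL Sigma b g H x + e) ->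
  (n + beta) * (u x0 - w x0) <=
    e + eta * (2 / rho ^+ 2 * (\tr Sigma + dot b b + rho ^+ 2)).
Proof.
move=> uB usub beta0 n0 eta0 rho0 wC ballO uw fw.
have rho20 : 0 < rho ^+ 2 by rewrite exprn_gt0.
pose c : R := eta * (2 / rho ^+ 2).
have c0 : 0 <= c by rewrite mulr_ge0// divr_ge0// ltW.
have wJ := BUC2_jet2 wC.
have pJ := jet2_lin c wJ (jet2_sqdist x0).
pose F x := u x + -1 * (w x + c * sqdist x0 x).
have Fc : continuous F.
  apply: continuous_lin; first by apply: unif_cont_continuous; case: uB.
  exact: (jet2_cont pJ).
pose K := [set x | sqdist x0 x <= rho ^+ 2].
have sq0 : sqdist x0 x0 = 0 by rewrite /sqdist subrr dot0l.
have KO x : K x -> O x.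
  move=> Kx; have := ballO (x - x0); rewrite [x0 + _]addrC subrK; apply.
  by apply: norm_le_dot => //; exact: ltW.
have Kcl : closed K.
  apply: (@preimage_closed _ _ (sqdist x0) [set t | t <= rho ^+ 2]).
    by move=> x _; exact: (jet2_cont (jet2_sqdist x0)).
  exact: closed_le.
have Kc : compact K.
  apply: (@col_compact _ _ K (rho + `|x0|)) => // x Kx.
  rewrite -{1}(subrK x0 x); apply: le_trans (ler_normD _ _) _; rewrite lerD2r.
  by apply: norm_le_dot => //; exact: ltW.
have K0 : K !=set0 by exists x0; rewrite /K/= sq0 ltW.
have [xh] := compact_EVT_max K0 Kc (continuous_subspaceT Fc).
rewrite inE => Kxh Fmax.
have F0 : F x0 <= F xh by apply: Fmax; rewrite inE /K/= sq0 ltW.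
have Fx0 : F x0 = u x0 - w x0 by rewrite /F sq0; ring.
have glob y : O y -> u y - (w y + c * sqdist x0 y) <= u xh - (w xh + c * sqdist x0 xh).
  move=> _; have -> : u xh - (w xh + c * sqdist x0 xh) = F xh by rewrite /F mulN1r.
  have [Ky|Ky] := leP (sqdist x0 y) (rho ^+ 2).
    by have := Fmax y; rewrite inE /F !mulN1r; apply.
  apply: le_trans F0; rewrite Fx0.
  have : c * rho ^+ 2 <= c * sqdist x0 y by rewrite ler_wpM2l// ltW.
  have -> : c * rho ^+ 2 = 2 * eta by rewrite /c; field; rewrite gt_eqF.
  by have := uw y; have := uw x0; rewrite !ler_norml; lra.
have := usub _ _ (KO _ Kxh) (jet2_C2_on O pJ) glob.
rewrite (jet2_calL _ _ _ pJ) jetL_lin jetL_sqdist => sub.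
have h1 := fw xh.
have h2 := dot2_upper b (xh - x0).
have h3 : c * (2 * dot b (xh - x0)) <= c * (dot b b + rho ^+ 2).
  by apply: ler_wpM2l => //; apply: le_trans h2 _; rewrite lerD2l.
have h4 : u x0 - w x0 <= u xh - w xh.
  rewrite -Fx0; apply: le_trans F0 _; rewrite /F.
  have : 0 <= c * sqdist x0 xh by rewrite mulr_ge0// dot_ge0.
  by lra.
have h5 : (n + beta) * (u x0 - w x0) <= (n + beta) * (u xh - w xh).
  by rewrite ler_wpM2l// addr_ge0.
rewrite mulrA -/c; lra.
Qed.

Lemma moment_bound (R : realType) (lam C K L S : R) : 1 < lam -> 0 <= K ->
  lam * (lam - 1) * S <= C -> K * C <= (lam - 1) * L -> lam * (K * S) <= L.
Proof.
move=> lam1 K0 SC KL; have lam10 : 0 < lam - 1 by lra.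
rewrite -(ler_pM2l lam10); apply: le_trans KL.
by have := ler_wpM2l K0 SC; lra.
Qed.

(** The weights [n A] have mass close to one and small second moment, so
    they hardly displace a uniformly continuous function. *)
Lemma resolvent_near (R : realType) (k : nat) (beta : R) (f u G : 'cV[R]_k -> R)
    (A : seq (R * 'cV[R]_k)) (n e eta q K Bu Bf : R) x :
  0 <= beta -> nneg A -> 0 <= n -> 1 - e <= (n + beta) * mass A <= 1 ->
  (forall y, `|G y - (f y + n * u y)| <= q) ->
  (forall y, `|u y| <= Bu) -> (forall y, `|f y| <= Bf) ->
  (forall y, `|u y - u x| <= eta / 4 + K * sqdist x y) ->
  0 <= eta -> 0 <= K -> (n + beta) * (K * shiftop A (sqdist x) x) <= eta / 8 ->
  mass A * (Bf + q) <= eta / 8 -> e * Bu <= eta / 8 ->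
  mass A * (beta * Bu) <= eta / 8 ->
  `|u x - shiftop A G x| <= eta.
Proof.
move=> b0 A0 n0 /andP[mA1 mA2] Gnear uBd fBd umod eta0 K0 mom P3 e2 P4.
have mA0 := mass_ge0 A0.
have S0 : 0 <= shiftop A (sqdist x) x.
  have := @shiftop_le _ _ A (fun=> 0) (sqdist x) x A0.
  by rewrite shiftop_cst mulr0; apply => y; exact: dot_ge0.
have P1 : `|shiftop A G x - n * shiftop A u x| <= mass A * (Bf + q).
  have := @shiftop_dist _ _ A G (fun y => 0 + n * u y) (Bf + q) x A0.
  rewrite (shiftop_lin A n (fun=> 0)) shiftop_cst mulr0 add0r; apply => y.
  move: (Gnear y) (fBd y); clear; rewrite !ler_norml; lra.
have P2 : `|n * (shiftop A u x - mass A * u x)| <= eta / 4 + eta / 8.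
  rewrite normrM (ger0_norm n0).
  apply: (@le_trans _ _ ((n + beta) * (eta / 4 * mass A + K * shiftop A (sqdist x) x))).
    apply: ler_pM => //; first by rewrite lerDl.
    exact: shiftop_osc.
  rewrite mulrDr; apply: lerD => //.
  by rewrite mulrCA -[leRHS]mulr1 ler_wpM2l// divr_ge0.
have P5 : `|n * (mass A * u x) - u x| <= eta / 8 + eta / 8.
  have -> : n * (mass A * u x) - u x = ((n + beta) * mass A - 1) * u x - mass A * (beta * u x).
    by ring.
  apply: le_trans (ler_normB _ _) _; apply: lerD.
    rewrite normrM; apply: le_trans e2; apply: ler_pM => //.
    by rewrite ler_norml; move: mA1 mA2; clear; lra.
  rewrite !normrM (ger0_norm mA0) (ger0_norm b0); apply: le_trans P4.
  by rewrite !ler_wpM2l.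
move: P1 P2 P3 P5 eta0; clear.
set g := shiftop A G x; set s := shiftop A u x => P1 P2 P3 P5 eta0.
have -> : u x - g = - ((g - n * s) + n * (s - mass A * u x) + (n * (mass A * u x) - u x)).
  by ring.
rewrite normrN; apply: le_trans (ler_normD _ _) _.
by have := ler_normD (g - n * s) (n * (s - mass A * u x)); lra.
Qed.

(** Divided by [n + beta], the error [4 * q] is small compared with the
    contribution of [f] to the average, and the inequality is free of
    derivatives of [u], so it survives mollification.  The extra function [W], on which the weights
    invert the operator as well, is the mollification of [u] when the lemma is
    used. *)
Lemma resolvent_subsolution (R : realType) (k : nat) (Sigma : 'M[R]_k) (b : 'cV[R]_k)
    (beta : R) (f u : 'cV[R]_k -> R) (O : set 'cV[R]_k) :
  nonneg_definite Sigma -> 0 <= beta -> BUC f -> BUC u ->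
  linear_subsolution Sigma b beta f u O ->
  exists2 C : R, 0 <= C &
  forall (q N rho : R) (W : 'cV[R]_k -> R) (g : 'I_k -> 'cV[R]_k -> R) H,
  0 < q -> 0 < rho -> BUC2 W g H ->
  exists n A, [/\ 2 <= n /\ N <= n, nneg A /\ 2^-1 <= (n + beta) * mass A <= 1,
    forall x, (n + beta) * (n + beta - 1) * shiftop A (sqdist x) x <= C,
    forall x, (n + beta) * `|shiftop A (fun y => (n + beta) * W y + jetL Sigma b g H y) x
      - W x| <= q &
    forall x, (forall z, `|z| <= rho -> O (x + z)) ->
      (n + beta) * (u x - shiftop A (fun y => f y + n * u y) x) <= 4 * q].
Proof.
move=> Sigma_nd b0 fB uB usub.
have [ss SigmaE] := nonneg_definite_decomp Sigma_nd.
have [C C0 approx] := approx_resolvent b SigmaE.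
exists C => // q N rho W g H q0 rho0 WC.
have [[Bu uBd] _] := uB; have [[Bf fBd] _] := fB.
have Bu0 : 0 <= Bu by apply: le_trans (uBd 0).
have Bf0 : 0 <= Bf by apply: le_trans (fBd 0).
(* eta is the admissible distance between u and the resolvent *)
have [eta eta0 etaC] : exists2 eta : R, 0 < eta &
    eta * (2 / rho ^+ 2 * (\tr Sigma + dot b b + rho ^+ 2)) <= q.
  set c := _ * (_ + _); exists (q / (`|c| + 1)); first by rewrite divr_gt0// ltr_wpDl.
  rewrite mulrAC ler_pdivrMr ?ltr_wpDl// ler_wpM2l ?(ltW q0)//.
  by apply: le_trans (ler_norm c) _; rewrite lerDl.
have eta8 : 0 < eta / 8 by rewrite divr_gt0.
have [K K0 umod] := BUC_quadratic_modulus uB (divr_gt0 eta0 (ltr0Sn _ 3)).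
have KC0 : 0 <= K * C by rewrite mulr_ge0.
have bB0 : 0 <= beta * Bu by rewrite mulr_ge0.
(* every error is of order 1 / n *)
pose X : R := Bf + q + K * C + beta * Bu.
have X0 : 0 <= X by move: q0 Bf0 KC0 bB0; rewrite /X; clear; lra.
have [n [n2 nN nX]] : exists n : R, [/\ 2 <= n, N <= n & X <= (n - 1) * (eta / 8)].
  exists (2 + `|N| + X / (eta / 8)).
  have h1 : 0 <= X / (eta / 8) by rewrite divr_ge0// ltW.
  have h2 := ler_norm N; have h3 : 0 <= `|N| by [].
  split; rewrite -?ler_pdivrMr//; move: h1 h2 h3; clear; lra.
have n0 : 0 <= n by move: n2; clear; lra.
pose lam : R := n + beta.
have lam2 : 2 <= lam by move: n2 b0; rewrite /lam; clear; lra.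
have lam1 : 1 < lam by move: lam2; clear; lra.
have lam0 : 0 < lam by move: lam2; clear; lra.
have XE : X <= (lam - 1) * (eta / 8).
  apply: le_trans nX _; rewrite ler_wpM2r ?(ltW eta8)//.
  by rewrite lerD2r lerDl.
have gB : BUC (fun x => f x + n * u x) by exact: BUC_lin.
have [d d0 gU] := gB.2 _ q0.
have d20 : 0 < d / 2 by rewrite divr_gt0.
have [M' [M'A M'C]] := mollifier_exists k d20.
have [g1 [H1 GC]] := M'C _ gB.
set G := M' _ in GC.
have Gnear x : `|G x - (f x + n * u x)| <= q.
  apply: (avg_dist M'A) => // z zd; apply: gU.
  by move: zd d0; clear; lra.
have [e [e0 e1 e2 e3]] : exists e : R, [/\ 0 < e, e <= 2^-1, e * Bu <= eta / 8 & lam * e <= q].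
  have Bu1 : 0 < Bu + 1 by rewrite ltr_wpDl.
  exists (Num.min (2^-1) (Num.min (eta / 8 / (Bu + 1)) (q / lam))).
  set e := Num.min _ _.
  have h2 : e <= eta / 8 / (Bu + 1) by rewrite /e !ge_min lexx !orbT.
  have h3 : e <= q / lam by rewrite /e !ge_min lexx !orbT.
  have e0 : 0 < e by rewrite !lt_min invr_gt0 ltr0Sn /=; apply/andP; split; exact: divr_gt0.
  split => //; first by rewrite /e ge_min lexx.
    by move: h2 e0; rewrite ler_pdivlMr//; clear; lra.
  by move: h3; rewrite ler_pdivlMr// mulrC.
have [A [A0 /andP[mA1 mA2] Asq AG AW]] := approx _ lam1 _ _ _ _ _ _ GC WC _ e0.
have mA0 := mass_ge0 A0.
have mX Y : 0 <= Y -> Y <= X -> mass A * Y <= eta / 8.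
  move=> Y0 YX; rewrite -(ler_pM2l lam0) mulrA.
  apply: (@le_trans _ _ Y); first by rewrite ler_piMl.
  apply: le_trans YX _; apply: le_trans XE _.
  by rewrite ler_wpM2r ?(ltW eta8)// gerBl.
have wnear x : `|u x - shiftop A G x| <= eta.
  apply: (@resolvent_near R k beta f u G A n e eta q K Bu Bf) => //; rewrite -/lam.
  - by rewrite mA1.
  - exact: ltW.
  - apply: (moment_bound lam1 K0 (Asq x)); apply: le_trans XE.
    by move: q0 Bf0 bB0; rewrite /X; clear; lra.
  - by apply: mX; move: q0 Bf0 bB0 KC0; rewrite /X; clear; lra.
  - by apply: mX => //; move: q0 Bf0 KC0; rewrite /X; clear; lra.
have fw x : f x + n * u x <= lam * shiftop A G x +
    jetL Sigma b (fun i => shiftop A (g1 i)) (fun i j => shiftop A (H1 i j)) x + 2 * q.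
  rewrite jetL_shiftop; have := AG x.
  rewrite (_ : shiftop A _ x = lam * shiftop A G x + shiftop A (jetL Sigma b g1 H1) x); last first.
    have := shiftop_lin A lam (jetL Sigma b g1 H1) G x.
    by rewrite addrC => <-; congr shiftop; apply/funext => y; rewrite addrC.
  have := Gnear x; have : e <= lam * e by rewrite ler_peMl// ltW.
  by move: e3; clear; rewrite !ler_norml; lra.
exists n, A; split => //.
- split => //; apply/andP; split => //.
  by apply: le_trans mA1; move: e1; clear; lra.
- by move=> x; apply: le_trans e3; rewrite ler_wpM2l// ltW.
- move=> x bO; rewrite -/lam.
  have := barrier_comparison uB usub b0 n0 (ltW eta0) rho0 (shiftop_BUC2 A GC) bO wnear fw.
  have : lam * `|shiftop A G x - shiftop A (fun z => f z + n * u z) x| <= q.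
    apply: (@le_trans _ _ (lam * (mass A * q))); last by rewrite mulrA ler_piMl// ltW.
    by rewrite ler_wpM2l ?(ltW lam0)//; exact: shiftop_dist.
  have := ler_wpM2l (ltW lam0) (ler_norm (shiftop A G x - shiftop A (fun z => f z + n * u z) x)).
  by rewrite -/lam; move: etaC; clear; lra.
Qed.

(** For the mollified function the resolvent inequality says that the
    average [A chi] of the defect [chi] is at most of order [q / lam]; since
    [lam A] is close to the identity, [chi] itself is at most of order [q]. *)
Lemma mollified_subsolution (R : realType) (k : nat) (Sigma : 'M[R]_k) (b : 'cV[R]_k)
    (beta : R) (f u : 'cV[R]_k -> R) (O : set 'cV[R]_k)
    rho eps (M : ('cV[R]_k -> R) -> 'cV[R]_k -> R) (g : 'I_k -> 'cV[R]_k -> R) H x0 :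
  nonneg_definite Sigma -> 0 <= beta -> BUC f -> BUC u ->
  linear_subsolution Sigma b beta f u O -> 0 < rho -> averaging eps M -> BUC2 (M u) g H ->
  (forall z, `|z| <= eps + rho -> O (x0 + z)) ->
  beta * M u x0 + jetL Sigma b g H x0 <= M f x0.
Proof.
move=> Sigma_nd b0 fB uB usub rho0 MA WC ballO.
have [C C0 resolvent] := resolvent_subsolution Sigma_nd b0 fB uB usub.
apply/ler_addgt0Pr => kappa kappa0.
pose q : R := kappa / 14.
have q0 : 0 < q by rewrite divr_gt0.
pose chi x := (jetL Sigma b g H x + beta * M u x) + -1 * M f x.
have chiB : BUC chi.
  apply: BUC_lin; last exact: (avg_BUC MA fB).
  by apply: BUC_lin (BUC2_BUC WC); exact: (jetL_BUC Sigma b WC).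
suff : chi x0 <= kappa by rewrite /chi; clear; lra.
have [K K0 chimod] := BUC_quadratic_modulus chiB q0.
have [n [A [[n2 nK] [A0 /andP[mA1 mA2]] Asq AW ucmp]]] :=
  resolvent q (1 + K * C / q) rho _ _ _ q0 rho0 WC.
move: mA1 mA2 Asq AW ucmp; set lam := n + beta => mA1 mA2 Asq AW ucmp.
have lam1 : 1 < lam by move: n2 b0; rewrite /lam; clear; lra.
have lam0 : 0 < lam by move: lam1; clear; lra.
have KE : K * C <= (lam - 1) * q.
  by rewrite -ler_pdivrMr//; move: nK b0; rewrite /lam; clear; lra.
have gB : BUC (fun x => f x + n * u x) by exact: BUC_lin.
have AB := shiftop_BUC A gB.
(* averaging commutes with translations: the resolvent inequality is averaged *)
have Mcmp : lam * (M u x0 - shiftop A (M (fun z => f z + n * u z)) x0) <= 4 * q.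
  rewrite -(averaging_shiftop A x0 MA gB) -(avg_sub MA x0 uB AB) mulrC -ler_pdivlMr//.
  apply: (avg_local MA).
    by have := BUC_lin (-1) uB AB; congr BUC; apply/funext => y; rewrite mulN1r.
  move=> z zd; rewrite ler_pdivlMr// mulrC; apply: ucmp => z' zr.
  by rewrite -addrA; apply: ballO; apply: le_trans (ler_normD _ _) _; exact: lerD.
have Achi : lam * shiftop A chi x0 <= 5 * q.
  have -> : shiftop A chi x0 =
     shiftop A (fun y => lam * M u y + jetL Sigma b g H y) x0 -
     shiftop A (M (fun z => f z + n * u z)) x0.
    rewrite -[- shiftop A _ _]mulN1r -shiftop_lin; congr shiftop; apply/funext => y.
    by rewrite (avg_lin MA)// /chi /lam; ring.
  have := AW x0; have := ler_wpM2l (ltW lam0) (ler_norm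
    (shiftop A (fun y => lam * M u y + jetL Sigma b g H y) x0 - M u x0)).
  by move: Mcmp; clear; lra.
have := shiftop_osc A0 (chimod x0).
rewrite ler_norml => /andP[h _].
have h3 := ler_wpM2l (ltW lam0) h.
have h2 := moment_bound lam1 K0 (Asq x0) KE.
have h1 : lam * (q * mass A) <= q by rewrite mulrCA -[leRHS]mulr1 ler_wpM2l// ltW.
have h4 : (lam * mass A) * chi x0 <= 7 * q by move: h1 h2 h3 Achi; clear; lra.
have [c0|c0] := leP (chi x0) 0; first exact: le_trans c0 (ltW kappa0).
have h5 : 2^-1 * chi x0 <= (lam * mass A) * chi x0.
  by apply: ler_wpM2r; [exact: ltW |].
have qE : 14 * q = kappa by rewrite /q; field.
by move: h4 h5 qE; clear; lra.
Qed.

(** * Uniformly continuous extensions and cones *)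

Section Extension.
Variables (R : realType) (k : nat).
Notation V := 'cV[R]_k.

Lemma norm_sub_cont : continuous (fun p : V * V => `|p.1 - p.2|).
Proof.
move=> p; apply: cvg_norm; apply: cvgB; [exact: cvg_fst | exact: cvg_snd].
Qed.

(** On the compact set of pairs where [f] varies by at least [e], the
    distance attains a minimum, and this minimum is positive. *)
Lemma compact_unif_continuous (Q : set V) (f : V -> R) : compact Q -> continuous f ->
  forall e : R, 0 < e -> exists2 d : R, 0 < d &
    forall x y, Q x -> Q y -> `|y - x| < d -> `|f y - f x| <= e.
Proof.
move=> Qc fc e e0.
pose F (p : V * V) := `|f p.1 - f p.2|.
have Fc : continuous F.
  move=> p; apply: cvg_norm; apply: cvgB.
    apply: cvg_comp; [exact: cvg_fst | exact: fc].
  apply: cvg_comp; [exact: cvg_snd | exact: fc].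
pose B := (Q `*` Q) `&` [set p | e <= F p].
have Bc : compact B.
  apply: (@subclosed_compact _ _ (Q `*` Q)); last first.
  - by move=> p [].
  - exact: compact_setX.
  apply: closedI; first by apply: compact_closed; [exact: norm_hausdorff | exact: compact_setX].
  by apply: (@preimage_closed _ _ F [set t | e <= t]) => //; exact: closed_ge.
have [[p0 Bp0]|B0] := pselect (B !=set0); last first.
  exists 1 => // x y Qx Qy _; rewrite leNgt; apply/negP => h; apply: B0.
  by exists (y, x); split; [split|exact: ltW].
have [p] := compact_EVT_min (ex_intro _ p0 Bp0) Bc (continuous_subspaceT norm_sub_cont).
rewrite inE => -[_ pe] pmin; exists `|p.1 - p.2|.
  rewrite normr_gt0 subr_eq0; apply/eqP => pp; move: pe.
  by rewrite /= /F pp subrr normr0 leNgt e0.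
move=> x y Qx Qy xy; rewrite leNgt; apply/negP => h.
have Byx : B (y, x) by split; [split|exact: ltW].
by have := pmin (y, x); rewrite inE => /(_ Byx) /=; rewrite leNgt xy.
Qed.

Definition clamp (B : R) (x : V) : V := \col_i Num.max (- B) (Num.min B (x i 0)).

Lemma clamp_id B x : `|x| <= B -> clamp B x = x.
Proof.
move=> xB; apply/matrixP => i j; rewrite (ord1 j) mxE.
have := le_trans (coord_le_norm x i) xB; rewrite ler_norml => /andP[h1 h2].
by rewrite (min_idPr h2) (max_idPr h1).
Qed.

Lemma clamp_norm B x : 0 <= B -> `|clamp B x| <= B.
Proof.
move=> B0; apply: norm_le_coord => // i; rewrite mxE ler_norml.
by rewrite le_max lexx ge_max ge_min lexx !andbT/=; lra.
Qed.

Lemma clamp_lip B x y : `|clamp B x - clamp B y| <= `|x - y|.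
Proof.
apply: norm_le_coord => // i; have := coord_le_norm (x - y) i.
rewrite !mxE; apply: le_trans.
set s := x i 0; set t := y i 0.
wlog st : s t / s <= t.
  move=> W; have [|/ltW] := leP s t; first exact: W.
  by move/W; rewrite distrC [leRHS]distrC.
rewrite (ler0_norm (_ : s - t <= 0)); last by lra.
rewrite /Num.max /Num.min.
by do ![case: ifP => //=]; move=> *; rewrite ler_norml; lra.
Qed.

(** The continuous extension of Tietze need not be uniformly continuous;
    composing it with the projection onto a cube makes it so, since only the values
    on a compact set are then used. *)
Lemma BUC_extension (K : set V) (B : R) (f : V -> R) : closed K ->
  (forall x, K x -> `|x| <= B) -> {within K, continuous f} ->
  exists2 g, BUC g & forall x, K x -> g x = f x.
Proof.
move=> Kcl KB fc.
have Kc := col_compact Kcl KB.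
have [[x0 Kx0]|K0] := pselect (K !=set0); last first.
  by exists (fun=> 0); [exact: BUC_cst | move=> x Kx; case: K0; exists x].
have B0 : 0 <= B by apply: le_trans (KB _ Kx0).
have [M M0 fM] : exists2 M, 0 < M & forall x, K x -> `|f x| <= M.
  have [xm _ xmax] := compact_EVT_max (ex_intro _ x0 Kx0) Kc fc.
  have [xn _ xmin] := compact_EVT_min (ex_intro _ x0 Kx0) Kc fc.
  exists (1 + `|f xm| + `|f xn|); first by rewrite -addrA ltr_pwDl// addr_ge0.
  move=> x Kx; have := xmax x; have := xmin x; rewrite inE => /(_ Kx) h1 /(_ Kx) h2.
  have := ler_norm (f xm); have := ler_norm (- f xn); rewrite normrN.
  have : 0 <= `|f xm| by []; have : 0 <= `|f xn| by [].
  by rewrite ler_norml; lra.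
have [g [gK gc gM]] := continuous_bounded_extension (@pseudometric_normal R V) Kcl M0 fc fM.
pose Q := [set x : V | `|x| <= B].
have Qcl : closed Q.
  apply: (@preimage_closed _ _ (fun x : V => `|x|) [set t | t <= B]); last exact: closed_le.
  by move=> x _; exact: norm_continuous.
have Qc : compact Q by apply: (@col_compact _ _ Q B).
exists (fun x => g (clamp B x)).
  split; first by exists M.
  move=> e e0; have [d d0 H] := compact_unif_continuous Qc gc e0.
  exists d => // x z zd; apply: H; rewrite ?/Q/=; try exact: clamp_norm.
  by apply: le_lt_trans (clamp_lip _ _ _) _; rewrite addrC addKr.
by move=> x Kx; rewrite clamp_id ?KB//; apply/esym/gK; rewrite inE.
Qed.

Lemma interior_ball (S : set V) x (d : R) : 0 < d -> (forall z, `|z| < d -> S (x + z)) -> S° x.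
Proof.
move=> d0 H; apply: filterS (@nbhsx_ballx _ V x d d0) => y.
rewrite mx_norm_ball /ball_/= distrC => /H.
by rewrite [x + _]addrC subrK.
Qed.

Lemma ball_of_interior (S : set V) x : S° x -> exists2 d : R, 0 < d &
  forall z, `|z| < d -> S (x + z).
Proof.
move/nbhs_ballP => [d /= d0 H]; exists d => // z zd; apply: H.
by rewrite mx_norm_ball /ball_/= opprD addrA subrr sub0r normrN.
Qed.

Lemma cone_add (C : set V) x y : convex_set C -> cone C -> C x -> C y -> C (x + y).
Proof.
move=> Ccvx Ccone Cx Cy.
have h0 : 0 <= 2^-1 :> R by rewrite invr_ge0.
have h1 : 2^-1 <= 1 :> R by lra.
have := Ccvx x y (Itv01 h0 h1); rewrite !inE => /(_ Cx Cy) h.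
have {}h : C (2^-1 *: x + (1 - 2^-1) *: y) by exact: h.
have two : 0 <= 2 :> R by [].
have := Ccone 2 _ two h; congr C.
rewrite scalerDr !scalerA divff// scale1r (_ : 2 * (1 - 2^-1) = 1) ?scale1r//.
by field.
Qed.

End Extension.

(** * Hamiltonian and truncated cone *)

Section Hamiltonian.
Variables (R : realType) (k p : nat) (G : 'M[R]_(k, p)) (Y : set 'cV[R]_p)
  (h : 'cV[R]_p -> R).
Hypothesis h_ge0 : forall y, Y y -> 0 <= h y.

(** By the Cauchy-Schwarz inequality and the sign of [h], the supremum is taken
    over a set bounded above, so it is a genuine supremum. *)
Lemma calH_ge q y : Y y -> enorm (G *m y) = 1 ->
  - (dot (G *m y) q + h y) <= calH G Y h q.
Proof.
move=> Yy Gy; apply: ub_le_sup; last by exists y.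
exists (enorm q) => _ [z [Yz Gz] <-].
have := cauchy_schwarz (- (G *m z)) q; rewrite dotNl.
have -> : enorm (- (G *m z)) = 1 by rewrite -Gz /enorm dotNl dotNr opprK.
by have := h_ge0 Yz; lra.
Qed.

Hypotheses (Y_cone : cone Y) (k_gt0 : (0 < k)%N)
  (U_int : [set G *m y | y in Y]° !=set0).

(** Without such a control the supremum in [calH] would run over the empty
    set and the Hamiltonian could not be negative. *)
Lemma unit_control : exists2 y, Y y & enorm (G *m y) = 1.
Proof.
have [y Yy Gy0] : exists2 y, Y y & G *m y != 0.
  have [q Uq] := U_int; have [y Yy yq] := interior_subset Uq.
  have [q0|q0] := eqVneq q 0; last by exists y => //; rewrite yq.
  have [d d0 Ud] := ball_of_interior Uq.
  pose e := unit_vec R (Ordinal k_gt0).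
  (* if 0 is the interior point found first, move away from it *)
  have [|z Yz zE] := Ud (d / 2 *: e).
    rewrite normrZ ger0_norm ?divr_ge0 ?ltW//.
    apply: (@le_lt_trans _ _ (d / 2 * 1)); last by lra.
    by rewrite ler_wpM2l ?norm_unit_vec// divr_ge0// ltW.
  exists z => //; rewrite zE q0 add0r scaler_eq0 negb_or gt_eqF ?divr_gt0//=.
  apply/eqP => /matrixP /(_ (Ordinal k_gt0) 0); rewrite !mxE !eqxx /= => /eqP.
  by rewrite oner_eq0.
have n0 : 0 < enorm (G *m y).
  by apply: lt_le_trans (norm_le_enorm _); rewrite normr_gt0.
have NE := sqr_enorm (G *m y).
move: n0 NE; set N := enorm (G *m y) => n0 NE.
exists (N^-1 *: y); first by apply: Y_cone => //; rewrite invr_ge0 ltW.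
by rewrite -scalemxAr /enorm dotZl dotZr -NE mulrA -expr2 -exprMn mulVf ?gt_eqF// expr1n sqrtr1.
Qed.

Lemma calH_le q c : (forall y, Y y -> enorm (G *m y) = 1 ->
  - (dot (G *m y) q + h y) <= c) -> calH G Y h q <= c.
Proof.
move=> H; apply: ge_sup.
  by have [y Yy Gy] := unit_control; exists (- (dot (G *m y) q + h y)), y.
by move=> _ [z [Yz Gz] <-]; exact: H.
Qed.

End Hamiltonian.

Section Truncation.
Variables (R : realType) (k : nat).
Notation V := 'cV[R]_k.
Variables (X : set V) (u1 : V) (a0 r : R).
Hypotheses (X_closed : closed X) (X_cone : cone X) (a0_gt0 : 0 < a0) (r_gt0 : 0 < r)
  (X_u1 : forall x, X x -> a0 * enorm x <= dot x u1).

Lemma cone_dot_ge0 x : X x -> 0 <= dot x u1.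
Proof.
by move/X_u1; apply: le_trans; rewrite mulr_ge0 ?enorm_ge0// ltW.
Qed.

Lemma cone_norm_le x : X x -> `|x| <= dot x u1 / a0.
Proof.
move=> Xx; rewrite ler_pdivlMr// mulrC; apply: le_trans (X_u1 Xx).
by rewrite ler_wpM2l ?norm_le_enorm// ltW.
Qed.

(** A point of the outer boundary is a limit of its own contractions towards
    the vertex of the cone. *)
Lemma closure_XltE x : closure (Xlt X u1 r) x <-> X x /\ dot x u1 <= r.
Proof.
have cl : closed [set x | X x /\ dot x u1 <= r].
  apply: closedI => //.
  apply: (@preimage_closed _ _ (fun x => dot x u1) [set t | t <= r]); last exact: closed_le.
  by move=> y _; exact: (jet2_cont (jet2_dot u1)).
split.
  have : Xlt X u1 r `<=` [set x | X x /\ dot x u1 <= r].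
    by move=> y [Xy yr]; split => //; exact: ltW.
  by move/closureS => H /H; rewrite -((closure_id _).1 cl).
move=> [Xx xr] B /nbhs_ballP [d /= d0 Bd].
have x1 : 0 < `|x| + 1 by rewrite ltr_wpDl.
pose s : R := Num.min 1 (d / 2 / (`|x| + 1)).
have s0 : 0 < s by rewrite lt_min ltr01 !divr_gt0.
have s1 : s <= 1 by rewrite /s ge_min lexx.
exists ((1 - s) *: x); split.
  split; first by apply: X_cone => //; rewrite subr_ge0.
  rewrite dotZl; apply: (@le_lt_trans _ _ ((1 - s) * r)).
    by rewrite ler_wpM2l// subr_ge0.
  by have := mulr_gt0 s0 r_gt0; lra.
apply: Bd; rewrite mx_norm_ball /ball_/= scalerBl scale1r opprB addrCA subrr addr0.
rewrite normrZ gtr0_norm//.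
apply: (@le_lt_trans _ _ (s * (`|x| + 1))); first by rewrite ler_wpM2l ?lerDl// ltW.
have : s <= d / 2 / (`|x| + 1) by rewrite /s ge_min lexx orbT.
by rewrite ler_pdivlMr// => h; lra.
Qed.

Lemma closure_Xlt_norm x : closure (Xlt X u1 r) x -> `|x| <= r / a0.
Proof.
move/closure_XltE => [Xx xr]; apply: le_trans (cone_norm_le Xx) _.
by rewrite ler_pM2r ?invr_gt0.
Qed.

End Truncation.

(** * Comparison and uniqueness *)

Section Subsolutions.
Variables (R : realType) (k p : nat) (G : 'M[R]_(k, p)) (Y : set 'cV[R]_p)
  (h : 'cV[R]_p -> R).
Notation V := 'cV[R]_k.
Hypothesis h_ge0 : forall y, Y y -> 0 <= h y.

Lemma BUC2_shift (f : V -> R) (g : 'I_k -> V -> R) H z : BUC2 f g H ->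
  BUC2 (fun x => f (x + z)) (fun i x => g i (x + z)) (fun i j x => H i j (x + z)).
Proof. by case=> *; split=> *; (exact: BUC_shift || exact: unif_derive_shift). Qed.

(** The inequality [hjb <= 0] is a family of linear inequalities, one for
    the diffusion and one for each control.  [lt] and [ut] extend [l] and [u] beyond the
    domain, so that averages make sense everywhere. *)
Lemma mollified_hjb_subsolution (beta : R) (b : V) (Sigma : 'M[R]_k) (l u lt ut : V -> R)
    (O : set V) eps rho M (g : 'I_k -> V -> R) H x0 :
  nonneg_definite Sigma -> 0 <= beta -> BUC lt -> BUC ut ->
  (forall x, O x -> lt x = l x) -> (forall x, O x -> ut x = u x) ->
  viscosity_subsolution (hjb G Y h beta b Sigma l) O u ->
  0 < rho -> averaging eps M -> BUC2 (M ut) g H ->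
  (forall z, `|z| <= eps + rho -> O (x0 + z)) ->
  beta * M ut x0 + jetL Sigma b g H x0 <= M lt x0 /\
  forall y, Y y -> enorm (G *m y) = 1 ->
    - (\sum_i (G *m y) i 0 * g i x0 + h y) <= 0.
Proof.
move=> Snd beta0 lB uB lE uE [_ usub] rho0 MA WC bO.
have sub x phi : O x -> C2_on O phi -> (forall y, O y -> ut y - phi y <= ut x - phi x) ->
    hjb G Y h beta b Sigma l x (u x) phi <= 0.
  by move=> Ox pC pm; apply: usub => // y Oy; rewrite -!uE//; exact: pm.
split.
  apply: (mollified_subsolution Snd beta0 lB uB _ rho0 MA WC bO).
  move=> x phi Ox pC pm; have := sub x phi Ox pC pm.
  by rewrite /hjb ge_max uE// lE// => /andP[+ _]; rewrite subr_le0.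
move=> y Yy Gy.
have Z : nonneg_definite (0 : 'M[R]_k).
  by split; [rewrite trmx0 | move=> x; rewrite mul0mx dotC dot0l].
have hB : BUC (fun _ : V => h y) by exact: BUC_cst.
have := @mollified_subsolution R k 0 (G *m y) 0 (fun=> h y) ut O rho eps M g H x0
  Z (lexx 0) hB uB _ rho0 MA WC bO.
have -> : jetL 0 (G *m y) g H x0 = - \sum_i (G *m y) i 0 * g i x0.
  rewrite /jetL big1 ?mulr0 ?oppr0 ?add0r// => i _.
  by rewrite big1// => j _; rewrite mxE mul0r.
rewrite mul0r add0r (avg_cst MA) => K.
suff : - \sum_i (G *m y) i 0 * g i x0 <= h y by lra.
apply: K => x phi Ox pC pm.
have := sub x phi Ox pC pm; rewrite /hjb ge_max => /andP[_].
move/(le_trans (calH_ge h_ge0 (grad phi x) Yy Gy)).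
by rewrite mul0r add0r /calL mul0mx mxtrace0 mulr0 oppr0; lra.
Qed.

End Subsolutions.

(** The test function is the mollification of [u] translated by [s *: e0], plus
    [th * dot x u1].  With [m] the supposed value of [u - v] at one point, all
    errors are measured against [ka], at most a tenth of [m] and of [beta * m]. *)
Lemma comparison (R : realType) (k p : nat) (k_gt0 : (0 < k)%N) (G : 'M[R]_(k, p))
    (X : set 'cV[R]_k) (Y : set 'cV[R]_p)
    (X_cone : solid_closed_convex_cone X) (Y_cone : cone Y)
    (U_int : [set G *m y | y in Y]° !=set0)
    (u1 : 'cV[R]_k) (a0 : R) (u1_unit : enorm u1 = 1) (a0_gt0 : 0 < a0)
    (U_u1 : forall y, Y y -> a0 * enorm (G *m y) <= dot (G *m y) u1)
    (X_u1 : forall x, X x -> a0 * enorm x <= dot x u1)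
    (beta : R) (beta_gt0 : 0 < beta) (b : 'cV[R]_k) (Sigma : 'M[R]_k)
    (Sigma_nd : nonneg_definite Sigma) (h : 'cV[R]_p -> R)
    (h_ge0 : forall y, Y y -> 0 <= h y)
    (l : 'cV[R]_k -> R) (l_cont : {within X, continuous l})
    (r : R) (r_gt0 : 0 < r) (u v : 'cV[R]_k -> R) :
  viscosity_subsolution (hjb G Y h beta b Sigma l) (Xlt X u1 r)° u ->
  viscosity_supersolution (hjb G Y h beta b Sigma l) (Xlt X u1 r) v ->
  {within closure (Xlt X u1 r), continuous u} ->
  (forall x, Xeq X u1 r x -> u x <= v x) ->
  forall x, closure (Xlt X u1 r) x -> u x <= v x.
Proof.
move=> u_sub [[v_cont _] v_super] u_cont uv_bd xb Dxb.
have [X_closed X_convex X_con [e0 Xe0]] := X_cone.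
set D := closure (Xlt X u1 r) in u_cont v_cont Dxb.
have DE x : D x <-> X x /\ dot x u1 <= r by exact: closure_XltE.
have Dcl : closed D by exact: closed_closure.
have Dn x : D x -> `|x| <= r / a0 by exact: closure_Xlt_norm.
have DX : D `<=` X by move=> x /DE[].
have [ut uB uE] := BUC_extension Dcl Dn u_cont.
have [vt vB vE] := BUC_extension Dcl Dn v_cont.
have [lt lB lE] := BUC_extension Dcl Dn (continuous_subspaceW DX l_cont).
rewrite leNgt; apply/negP => uv.
pose m : R := u xb - v xb.
have m0 : 0 < m by rewrite subr_gt0.
have bm0 : 0 < beta * m by exact: mulr_gt0.
have [ka [ka0 kam kabm]] : exists ka : R, [/\ 0 < ka, 10 * ka <= m & 10 * ka <= beta * m].
  exists (Num.min m (beta * m) / 10).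
  have h1 : 0 < Num.min m (beta * m) by rewrite lt_min m0.
  have h2 : Num.min m (beta * m) <= m by rewrite ge_min lexx.
  have h3 : Num.min m (beta * m) <= beta * m by rewrite ge_min lexx orbT.
  by split; lra.
(* th is the slope of the linear perturbation; T collects what it multiplies *)
pose T : R := r + beta * r + `|dot b u1| + 1.
have br0 : 0 < beta * r by exact: mulr_gt0.
have T0 : 0 < T by have : 0 <= `|dot b u1| by []; rewrite /T; lra.
have [th th0 thT] : exists2 th : R, 0 < th & th * T = ka.
  by exists (ka / T); [exact: divr_gt0 | rewrite divfK// gt_eqF].
have thr : th * r <= ka.
  rewrite -thT ler_wpM2l ?(ltW th0)// /T.
  have : 0 <= `|dot b u1| by []; lra.
have thb : th * (beta * r + `|dot b u1|) <= ka.
  by rewrite -thT ler_wpM2l ?(ltW th0)// /T; lra.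
have [d [d0 ud vd ld]] : exists d : R, [/\ 0 < d,
    forall x z, `|z| < d -> `|ut (x + z) - ut x| <= ka,
    forall x z, `|z| < d -> `|vt (x + z) - vt x| <= ka &
    forall x z, `|z| < d -> `|lt (x + z) - lt x| <= ka].
  have [d1 d10 H1] := uB.2 _ ka0; have [d2 d20 H2] := vB.2 _ ka0.
  have [d3 d30 H3] := lB.2 _ ka0.
  exists (Num.min d1 (Num.min d2 d3)); split; first by rewrite !lt_min d10 d20.
  - by move=> x z; rewrite !lt_min => /and3P[? ? ?]; exact: H1.
  - by move=> x z; rewrite !lt_min => /and3P[? ? ?]; exact: H2.
  - by move=> x z; rewrite !lt_min => /and3P[? ? ?]; exact: H3.
(* t bounds the inward translation together with the mollification radius *)
have [de de0 Xe] := ball_of_interior Xe0.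
have k0 : 0 < k%:R :> R by rewrite ltr0n.
pose E : R := `|e0| + de.
have E0 : 0 < E by rewrite ltr_wpDl.
have [t [t0 td tr ta]] : exists t : R, [/\ 0 < t, t < d, k%:R * t < r & k%:R * t < a0 * d].
  have m1 : 0 < Num.min d (Num.min (r / k%:R) (a0 * d / k%:R)).
    by rewrite !lt_min d0 !divr_gt0// mulr_gt0.
  exists (Num.min d (Num.min (r / k%:R) (a0 * d / k%:R)) / 2).
  set mm := Num.min d _ in m1 *.
  have m2 : mm / 2 < mm by lra.
  have m3 : mm <= d by rewrite /mm ge_min lexx.
  have m4 : mm <= r / k%:R by rewrite /mm !ge_min lexx !orbT.
  have m5 : mm <= a0 * d / k%:R by rewrite /mm !ge_min lexx !orbT.
  split; first by lra.
  - exact: lt_le_trans m3.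
  - by rewrite mulrC -ltr_pdivlMr//; exact: lt_le_trans m4.
  - by rewrite mulrC -ltr_pdivlMr//; exact: lt_le_trans m5.
pose s : R := t / E.
have s0 : 0 < s by exact: divr_gt0.
have sE : s * E = t by rewrite /s divfK// gt_eqF.
have sde : s * `|e0| + s * de = t by rewrite -mulrDr sE.
have sde0 : 0 < s * de by exact: mulr_gt0.
have se0 : 0 <= s * `|e0| by rewrite mulr_ge0// ltW.
pose ep : R := s * de / 4.
have ep0 : 0 < ep by rewrite divr_gt0.
have [M [MA MC]] := mollifier_exists k ep0.
have [g [H WC]] := MC _ uB.
pose om x := M ut (x + s *: e0) + th * dot x u1.
have omJ : jet2 om _ _ := jet2_lin th (BUC2_jet2 (BUC2_shift (s *: e0) WC)) (jet2_dot u1).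
have shift_small z : `|z| <= s * de -> `|s *: e0 + z| <= t.
  move=> zs; apply: le_trans (ler_normD _ _) _.
  by rewrite normrZ (gtr0_norm s0) -sde lerD2l.
have Mnear f x : BUC f -> (forall x z, `|z| < d -> `|f (x + z) - f x| <= ka) ->
    `|M f (x + s *: e0) - f x| <= ka.
  move=> fB fd; apply: (avg_dist MA) => // z zep.
  rewrite -addrA; apply: fd; apply: le_lt_trans td; apply: shift_small.
  by apply: le_trans zep _; rewrite /ep; lra.
have un : `|u1| <= 1 by rewrite -u1_unit norm_le_enorm.
have inner x z : X x -> dot x u1 < r - k%:R * t -> `|z| < s * de ->
    Xlt X u1 r (x + s *: e0 + z).
  move=> Xx xr zs; split.
    rewrite -addrA; apply: cone_add => //.
    have -> : s *: e0 + z = s *: (e0 + s^-1 *: z).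
      by rewrite scalerDr scalerA divff ?gt_eqF// scale1r.
    apply: X_con; first exact: ltW.
    by apply: Xe; rewrite normrZ gtr0_norm ?invr_gt0// mulrC ltr_pdivrMr// mulrC.
  rewrite -addrA dotDl.
  have : dot (s *: e0 + z) u1 <= k%:R * t.
    apply: le_trans (dot_le_norm _ _) _; rewrite ler_wpM2l//.
    rewrite -[leRHS]mulr1; apply: ler_pM => //; apply: shift_small; exact: ltW.
  by lra.
have [xh Dxh xmin] : exists2 xh, D xh & forall x, D x -> vt xh - om xh <= vt x - om x.
  have Dc : compact D by exact: col_compact Dn.
  have c : continuous (fun x => vt x + -1 * om x).
    apply: continuous_lin; last exact: (jet2_cont omJ).
    by apply: unif_cont_continuous; case: vB.
  have [xh] := compact_EVT_min (ex_intro _ xb Dxb) Dc (continuous_subspaceT c).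
  rewrite inE => Dxh xm; exists xh => // x Dx.
  by have := xm x; rewrite inE => /(_ Dx); rewrite !mulN1r.
have [Xxb xbr] := (DE xb).1 Dxb; have [Xxh xhr] := (DE xh).1 Dxh.
have dot0 x (Xx : X x) : 0 <= dot x u1 := cone_dot_ge0 a0_gt0 X_u1 Xx.
have gap : om xh - vt xh >= 9 * ka.
  have := xmin xb Dxb; rewrite (vE xb Dxb).
  have := Mnear ut xb uB ud; rewrite ler_norml uE// => /andP[h1 _].
  have : 0 <= th * dot xb u1 by rewrite mulr_ge0 ?dot0// ltW.
  by rewrite /m in kam; rewrite /om; lra.
have om_le : om xh <= ut xh + 2 * ka.
  have := Mnear ut xh uB ud; rewrite ler_norml => /andP[_ h2].
  have : th * dot xh u1 <= th * r by rewrite ler_wpM2l// ltW.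
  by rewrite /om; lra.
have [xin|xout] := ltP (dot xh u1) (r - k%:R * t); last first.
  (* xh is close to its radial projection x' on the outer boundary *)
  have sp : 0 < dot xh u1 by lra.
  pose x' := (r / dot xh u1) *: xh.
  have Xx' : Xeq X u1 r x'.
    split; first by apply: X_con => //; rewrite divr_ge0 ?ltW.
    by rewrite /x' dotZl divfK// gt_eqF.
  have Dx' : D x' by apply/DE; split; [exact: Xx'.1 | rewrite Xx'.2].
  have near' : `|x' - xh| < d.
    have -> : x' - xh = (r / dot xh u1 - 1) *: xh by rewrite scalerBl scale1r.
    rewrite normrZ ger0_norm; last first.
      by rewrite subr_ge0 ler_pdivlMr// mul1r.
    have := cone_norm_le a0_gt0 X_u1 Xxh => xn.
    have q0 : 0 <= r / dot xh u1 - 1 by rewrite subr_ge0 ler_pdivlMr// mul1r.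
    apply: le_lt_trans (ler_wpM2l q0 xn) _.
    have -> : (r / dot xh u1 - 1) * (dot xh u1 / a0) = (r - dot xh u1) / a0.
      by field; rewrite !gt_eqF.
    by rewrite ltr_pdivrMr// [d * _]mulrC; apply: le_lt_trans ta; lra.
  have := uv_bd _ Xx'; rewrite -(vE _ Dx') -(uE _ Dx').
  have := ud xh _ near'; have := vd xh _ near'.
  rewrite [xh + _]addrC subrK !ler_norml => /andP[h1 h2] /andP[h3 h4] h5.
  by lra.
have Oin z : `|z| <= ep + ep -> (Xlt X u1 r)° (xh + s *: e0 + z).
  move=> zs; apply: (@interior_ball _ _ _ _ ep) => // w wep.
  rewrite -addrA; apply: inner => //.
  by apply: le_lt_trans (ler_normD _ _) _; rewrite /ep in zs wep; lra.
have OD x : (Xlt X u1 r)° x -> D x by move/interior_subset; exact: subset_closure.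
have [lin grad_ineq] := mollified_hjb_subsolution h_ge0 Sigma_nd (ltW beta_gt0) lB uB
  (fun x Ox => lE x (OD x Ox)) (fun x Ox => uE x (OD x Ox)) u_sub ep0 MA WC Oin.
have Sxh : Xlt X u1 r xh.
  by split => //; apply: lt_le_trans xin _; have := mulr_gt0 k0 t0; lra.
have XD x : Xlt X u1 r x -> D x by exact: subset_closure.
have vmin y : Xlt X u1 r y -> v xh - om xh <= v y - om y.
  by move=> Sy; rewrite -(vE xh Dxh) -(vE y (XD y Sy)); apply: xmin; exact: XD.
have := v_super xh om Sxh (jet2_C2_on _ omJ) vmin.
rewrite leNgt /hjb gt_max => /negP; apply; apply/andP; split.
  rewrite (jet2_calL _ _ _ omJ).
  have -> : jetL Sigma b (fun i x => g i (x + s *: e0) + th * u1 i 0)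
      (fun i j x => H i j (x + s *: e0) + th * 0) xh =
      jetL Sigma b g H (xh + s *: e0) + th * (- dot b u1).
    by rewrite jetL_lin jetL_dot.
  have := Mnear lt xh lB ld; rewrite ler_norml -lE// => /andP[_ h2].
  have h3 : beta * v xh <= beta * om xh - beta * (m - ka).
    rewrite -mulrBr ler_pM2l// -vE//.
    have := xmin xb Dxb; rewrite (vE xb)//.
    have := Mnear ut xb uB ud; rewrite ler_norml (uE xb)// => /andP[h1 _].
    have : 0 <= th * dot xb u1 by rewrite mulr_ge0 ?dot0// ltW.
    by rewrite /m /om; lra.
  have h4 : th * (beta * dot xh u1 - dot b u1) <= ka.
    apply: le_trans thb; rewrite ler_wpM2l ?(ltW th0)//.
    have : beta * dot xh u1 <= beta * r by rewrite ler_pM2l.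
    by have := ler_norm (- dot b u1); rewrite normrN; lra.
  have h5 : beta * ka <= beta * m / 10 by rewrite -mulrA ler_pM2l//; lra.
  by rewrite /om in h3; lra.
apply: (@le_lt_trans _ _ (- (th * a0))); last by rewrite oppr_lt0 mulr_gt0.
apply: calH_le => // y Yy Gy.
rewrite (jet2_gradE _ omJ).
have -> : dot (G *m y) (\col_i (g i (xh + s *: e0) + th * u1 i 0)) =
    \sum_i (G *m y) i 0 * g i (xh + s *: e0) + th * dot (G *m y) u1.
  rewrite /dot mulr_sumr -big_split; apply: eq_bigr => i _ /=.
  by rewrite [(\col_i _) _ _]mxE; ring.
have := grad_ineq y Yy Gy.
have := U_u1 y Yy; rewrite Gy mulr1 => /(ler_wpM2l (ltW th0)).
by lra.
Qed.

Theorem theorem6p2 (R : realType) (k p : nat) (k_gt0 : (0 < k)%N)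
    (k_le_p : (k <= p)%N) (G : 'M[R]_(k, p)) (rankG : \rank G = k)
    (X : set 'cV[R]_k) (Y : set 'cV[R]_p)
    (X_cone : solid_closed_convex_cone X)
    (Y_cone : solid_closed_convex_cone Y)
    (U_cone : solid_closed_convex_cone [set G *m y | y in Y])
    (UX : [set G *m y | y in Y] `&` X° !=set0)
    (u1 : 'cV[R]_k) (y1 : 'cV[R]_p) (a0 : R)
    (u1_unit : enorm u1 = 1) (y1_unit : enorm y1 = 1) (a0_gt0 : 0 < a0)
    (U_u1 : forall u, [set G *m y | y in Y] u -> a0 * enorm u <= dot u u1)
    (X_u1 : forall x, X x -> a0 * enorm x <= dot x u1)
    (Y_y1 : forall y, Y y -> a0 * enorm y <= dot y y1)
    (beta : R) (beta_gt0 : 0 < beta)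
    (b : 'cV[R]_k) (Sigma : 'M[R]_k) (Sigma_nd : nonneg_definite Sigma)
    (h : 'cV[R]_p -> R)
    (h_ge0 : forall y, Y y -> 0 <= h y)
    (h_convex : convex_function Y h)
    (h_lipschitz : [lipschitz h y | y in Y])
    (h_homogeneous : forall (a : R) (y : 'cV[R]_p),
      0 <= a -> Y y -> h (a *: y) = a * h y)
    (l : 'cV[R]_k -> R) (l_Cplus : Cplus X l)
    (cl1 cl2 cl3 ml : R)
    (cl1_gt0 : 0 < cl1) (cl2_gt0 : 0 < cl2) (cl3_gt0 : 0 < cl3)
    (ml_ge0 : 0 <= ml)
    (l_lower : forall x, X x -> cl1 * (enorm x) `^ ml - cl2 <= l x)
    (l_upper : forall x, X x -> l x <= cl3 * ((enorm x) `^ ml + 1))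
    (mhat : R -> R) (mhat_0 : mhat delta @[delta --> 0^'+] --> 0)
    (l_modulus : forall r delta : R, 0 < delta -> 0 < r ->
      modulus X l (r + 1) delta <= mhat delta * (1 + r `^ ml))
    (r : R) (r_gt0 : 0 < r)
    (phi : 'cV[R]_k -> R) (phi_Cplus : Cplus (Xeq X u1 r) phi)
    (u v : 'cV[R]_k -> R)
    (u_sol : constrained_viscosity_solution (hjb G Y h beta b Sigma l)
      X u1 r phi u)
    (v_sol : constrained_viscosity_solution (hjb G Y h beta b Sigma l)
      X u1 r phi v) :
  forall x, closure (Xlt X u1 r) x -> u x = v x.
Proof.
have [_ _ Yc _] := Y_cone; have [_ _ _ Ui] := U_cone.
have U_u1' y : Y y -> a0 * enorm (G *m y) <= dot (G *m y) u1.
  by move=> Yy; apply: U_u1; exists y.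
have [[uc _] usup usub ubd] := u_sol; have [[vc _] vsup vsub vbd] := v_sol.
move=> x Dx; apply/eqP; rewrite eq_le; apply/andP; split.
  apply: (comparison k_gt0 X_cone Yc Ui u1_unit a0_gt0 U_u1' X_u1 beta_gt0 Sigma_nd
    h_ge0 l_Cplus.1 r_gt0 usub vsup uc) => // y Xy.
  by rewrite ubd// vbd.
apply: (comparison k_gt0 X_cone Yc Ui u1_unit a0_gt0 U_u1' X_u1 beta_gt0 Sigma_nd
  h_ge0 l_Cplus.1 r_gt0 vsub usup vc) => // y Xy.
by rewrite ubd// vbd.
Qed.
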